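(* The following assertions are equivalent: (1) the Liapunov equation $AX+XA^*=-Q$ has a positive symmetric solution $X\in\mathcal L(E^*,E)$; (2) for every $x^*\in E^*$ the weak limit $\text{weak-}\lim_{t\to\infty}Q_tx^*$ exists in $E$. If these equivalent conditions are satisfied, the operator $Q_\infty$ defined by $Q_\infty x^*:=\text{weak-}\lim_{t\to\infty}Q_tx^*$ is a positive symmetric solution of $AX+XA^*=-Q$, which is minimal in the sense that if $R$ is another positive symmetric solution of this equation, then for all $x^*\in E^*$ we have $\langle Q_\infty x^*,x^*\rangle\le\langle Rx^*,x^*\rangle$.
   Context: $E$ is a real Banach space with dual $E^*$; $S=\{S(t)\}_{t\ge0}$ is a $C_0$-semigroup of bounded linear operators on $E$ with generator $A$ (domain $\mathcal D(A)$); $S^*(t)$ and $A^*$ (with domain $\mathcal D(A^* )$) are the adjoints on $E^*$. $H$ is a real Hilbert space with a continuous injective linear map $i:H\to E$, and $Q:=i\circ i^*\in\mathcal L(E^*,E)$ ($H$ being identified with its dual). For $t>0$, $Q_t x^*:=\int_0^t S(s)QS^*(s)x^*\,ds$ for $x^*\in E^*$. An operator $R\in\mathcal L(E^*,E)$ is positive if $\langle Rx^*,x^*\rangle\ge0$ for all $x^*\in E^*$, and symmetric if $\langle Rx^*,y^*\rangle=\langle Ry^*,x^*\rangle$ for all $x^*,y^*\in E^*$. A solution of the Liapunov equation $AX+XA^*=-Q$ is a bounded operator $X\in\mathcal L(E^*,E)$ such that for all $x^*\in\mathcal D(A^* )$ we have $Xx^*\in\mathcal D(A)$ and $AXx^*+XA^*x^*=-Qx^*$.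 *)

(* Defs.v *)
From HB Require Import structures.
From mathcomp Require Import all_boot all_order all_algebra.
From mathcomp Require Import all_classical all_reals all_analysis.
Set Implicit Arguments.
Unset Strict Implicit.
Unset Printing Implicit Defensive.
Import Order.TTheory GRing.Theory Num.Theory.
Import numFieldNormedType.Exports.
Local Open Scope classical_set_scope.
Local Open Scope ring_scope.

(* The normed space L(E, F) of bounded (equivalently, continuous) linear
   operators, with the operator norm. *)
Section bounded_operators.
Context (R : realType) (E F : normedModType R).

Definition bop_pred : {pred E -> F} :=
  fun f => `[< linear f /\ continuous f >].

Record bop := Bop { bop_fun :> E -> F ; bopP : bop_fun \in bop_pred }.
HB.instance Definition _ := [isSub for bop_fun].
HB.instance Definition _ := [Choice of bop by <:].

Lemma bop_submod_closed : submod_closed bop_pred.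
Proof.
split=> [|a f g /asboolP[lf cf] /asboolP[lg cg]]; apply/asboolP; split.
- by move=> a x y; rewrite scaler0 addr0.
- by move=> x; exact: cvg_cst.
- move=> b x y; rewrite !fctE lf lg !scalerDr !scalerA [a * b]mulrC.
  by rewrite addrACA.
- by move=> x; apply: cvgD; [apply: cvgZl_tmp; exact: cf|exact: cg].
Qed.
HB.instance Definition _ := GRing.isSubmodClosed.Build _ _ bop_pred
  bop_submod_closed.
HB.instance Definition _ := [SubChoice_isSubLmodule of bop by <:].

Lemma bop_linear (f : bop) : linear f.
Proof. by case: f => f /= /asboolP[]. Qed.

Lemma bop_continuous (f : bop) : continuous f.
Proof. by case: f => f /= /asboolP[]. Qed.

HB.instance Definition _ (f : bop) :=
  GRing.isLinear.Build R E F *:%R (bop_fun f) (bop_linear f).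

Definition opnorm (f : bop) : R := sup [set `|f x| | x in [set x | `|x| <= 1]].

Lemma opnorm_has_sup (f : bop) :
  has_sup [set `|f x| | x in [set x : E | `|x| <= 1]].
Proof.
split; first by exists `|f 0|, 0 => //=; rewrite normr0.
have /bounded_funP/(_ 1)[M fM] :=
  continuous_linear_bounded 0 (@bop_continuous f 0).
by exists M => _ [x /= x1 <-]; exact: fM.
Qed.

Lemma opnorm_le (f : bop) x : `|f x| <= opnorm f * `|x|.
Proof.
have [->|x0] := eqVneq x 0; first by rewrite linear0 !normr0 mulr0.
have nx0 : 0 < `|x| by rewrite normr_gt0.
rewrite -ler_pdivrMr//.
rewrite (_ : `|f x| / `|x| = `|f (`|x|^-1 *: x)|); last first.
  by rewrite linearZ/= normrZ normfV normr_id mulrC.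
apply: ub_le_sup; first by have [] := opnorm_has_sup f.
by exists (`|x|^-1 *: x) => //=; rewrite normrZ normfV normr_id mulVf ?gt_eqF.
Qed.

Lemma opnorm_lub (f : bop) (M : R) :
  (forall x, `|x| <= 1 -> `|f x| <= M) -> opnorm f <= M.
Proof.
move=> fM; apply: ge_sup; first by have [] := opnorm_has_sup f.
by move=> _ [x /= x1 <-]; exact: fM.
Qed.

Lemma opnorm_ge0 (f : bop) : 0 <= opnorm f.
Proof.
apply: ub_le_sup; first by have [] := opnorm_has_sup f.
by exists 0 => /=; rewrite ?linear0 normr0.
Qed.

Lemma opnormD (f g : bop) : opnorm (f + g) <= opnorm f + opnorm g.
Proof.
apply: opnorm_lub => x x1; rewrite (le_trans (ler_normD _ _))//.
by apply: lerD; apply: (le_trans (opnorm_le _ _)); rewrite ler_piMr ?opnorm_ge0.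
Qed.

Lemma opnormZ_le (a : R) (f : bop) : opnorm (a *: f) <= `|a| * opnorm f.
Proof.
apply: opnorm_lub => x x1; rewrite normrZ ler_wpM2l//.
by apply: (le_trans (opnorm_le _ _)); rewrite ler_piMr ?opnorm_ge0.
Qed.

Lemma opnormZ (a : R) (f : bop) : opnorm (a *: f) = `|a| * opnorm f.
Proof.
apply/eqP; rewrite eq_le opnormZ_le/=.
have [->|a0] := eqVneq a 0; first by rewrite normr0 mul0r opnorm_ge0.
rewrite -ler_pdivlMl ?normr_gt0// -normfV.
by rewrite -{1}[f]scale1r -(mulVf a0) -scalerA opnormZ_le.
Qed.

Lemma opnorm0_eq0 (f : bop) : opnorm f = 0 -> f = 0.
Proof.
move=> f0; apply/val_inj/funext => x; apply/eqP; rewrite -normr_le0.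
by rewrite (le_trans (opnorm_le f x))// f0 mul0r.
Qed.

HB.instance Definition _ :=
  Lmodule_isNormed.Build R bop opnormD opnormZ opnorm0_eq0.

End bounded_operators.

Definition dual (R : realType) (E : normedModType R) := bop E (R^o).

Definition bop_comp_fun (R : realType) (E F G : normedModType R)
  (g : bop F G) (f : bop E F) : E -> G := g \o f.

Lemma bop_compP (R : realType) (E F G : normedModType R)
  (g : bop F G) (f : bop E F) : bop_comp_fun g f \in @bop_pred R E G.
Proof.
apply/asboolP; split => [a x y|x]; first by rewrite /bop_comp_fun/= !linearP.
by apply: continuous_comp; exact: bop_continuous.
Qed.

Definition bop_adjoint (R : realType) (E F : normedModType R) (T : bop E F)
  (xs : dual F) : dual E := Bop (bop_compP xs T).

Section bochner.
Context d (T : measurableType d) (R : realType) (E : normedModType R).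

(* The simple function \sum_k \1_(A k) *: c k. *)
Record simple_function := SimpleFunction {
  sf_size : nat ;
  sf_set : 'I_sf_size -> set T ;
  sf_val : 'I_sf_size -> E ;
  sf_measurable : forall k, measurable (sf_set k) }.

Definition sf_eval (s : simple_function) (x : T) : E :=
  \sum_(k < sf_size s) (\1_(sf_set k) x : R) *: sf_val k.

Definition sf_integral (mu : {measure set T -> \bar R}) (D : set T)
    (s : simple_function) : E :=
  \sum_(k < sf_size s) fine (mu (D `&` sf_set k)) *: sf_val k.

(* The second clause is strong measurability of f on D; the third makes the
   integrals of the s n converge to the integral of f. *)
Definition is_bochner_integral (mu : {measure set T -> \bar R}) (D : set T)
    (f : T -> E) (v : E) : Prop :=
  exists s : nat -> simple_function,
    [/\ forall n k, (mu (D `&` @sf_set (s n) k) < +oo)%E,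
        {ae mu, forall x, D x -> sf_eval (s n) x @[n --> \oo] --> f x},
        (\int[mu]_(x in D) `|f x - sf_eval (s n) x|%:E)%E @[n --> \oo] --> 0%E
      & sf_integral mu D (s n) @[n --> \oo] --> v].

(* Junk value 0 when f is not Bochner integrable on D. *)
Definition bochner_integral (mu : {measure set T -> \bar R}) (D : set T)
    (f : T -> E) : E :=
  xget 0 [set v | is_bochner_integral mu D f v].

End bochner.

Section semigroup.
Context (R : realType) (E : normedModType R).

(* Only the values S t with 0 <= t are meaningful. *)
Definition C0_semigroup (S : R -> bop E E) : Prop :=
  [/\ forall x, S 0 x = x,
      forall s t x, 0 <= s -> 0 <= t -> S (s + t) x = S s (S t x)
    & forall x, S t x @[t --> 0^'+] --> x].

(* Unbounded operators are represented by their graphs: G x y means that x is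
   in the domain and is mapped to y. *)
Definition sg_generator (S : R -> bop E E) (x y : E) : Prop :=
  h^-1 *: (S h x - x) @[h --> 0^'+] --> y.

(* xs is in the domain of A^* and is mapped to ys, which is unique when A is
   densely defined. *)
Definition adjoint_graph (A : E -> E -> Prop) (xs ys : dual E) : Prop :=
  forall x y, A x y -> xs y = ys x.

Definition positive_op (X : dual E -> E) : Prop :=
  forall xs : dual E, 0 <= xs (X xs).

Definition symmetric_op (X : dual E -> E) : Prop :=
  forall xs ys : dual E, ys (X xs) = xs (X ys).

Definition liapunov_solution (A : E -> E -> Prop) (Q X : dual E -> E) : Prop :=
  [/\ linear X, continuous X
    & forall xs ys, adjoint_graph A xs ys ->
        exists2 y, A (X xs) y & y + X ys = - Q xs].

Definition positive_symmetric_solution (A : E -> E -> Prop)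
    (Q X : dual E -> E) : Prop :=
  [/\ liapunov_solution A Q X, positive_op X & symmetric_op X].

Definition weakly_cvg (F : set_system R) (u : R -> E) (l : E) : Prop :=
  forall ys : dual E, ys (u t) @[t --> F] --> ys l.

(* Junk value 0 when there is no weak limit. *)
Definition weak_lim (F : set_system R) (u : R -> E) : E :=
  xget 0 [set l | weakly_cvg F u l].

End semigroup.

Section covariance_op.
Context (R : realType) (E H : normedModType R).

(* The adjoint i^* : E^* -> H of i, where H is identified with its dual by the
   inner product: i^* xs is the Riesz representative of xs \o i. *)
Definition riesz_adjoint (ip : {dot H for idfun}) (i : bop H E) (xs : dual E)
    : H :=
  xget 0 [set h | forall g, ip h g = xs (i g)].

Definition covariance_op (ip : {dot H for idfun}) (i : bop H E) (xs : dual E)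
    : E :=
  i (riesz_adjoint ip i xs).

Definition Qt (S : R -> bop E E) (Q : dual E -> E) (t : R) (xs : dual E) : E :=
  bochner_integral lebesgue_measure `[0, t]
    (fun s => S s (Q (bop_adjoint (S s) xs))).

Definition Qinfty (S : R -> bop E E) (Q : dual E -> E) (xs : dual E) : E :=
  weak_lim +oo (fun t => Qt S Q t xs).

End covariance_op.

(* Main.v *)
Require Import Defs.
From HB Require Import structures.
From mathcomp Require Import all_boot all_order all_algebra.
From mathcomp Require Import all_classical all_reals all_analysis.
From mathcomp Require Import measurable_realfun lra ring.
Set Implicit Arguments.
Unset Strict Implicit.
Unset Printing Implicit Defensive.
Import Order.TTheory GRing.Theory Num.Theory.
Import numFieldNormedType.Exports.
Local Open Scope classical_set_scope.
Local Open Scope ring_scope.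

(** Write S*(t) for the adjoint of S(t), and put
      Q_t x = \int_0^t S(s) Q S*(s) x ds   (the map [qint S Q t] below).
    The whole theorem rests on the algebraic identity
      Q_(t+h) = Q_h + S(h) Q_t S*(h)       ([qint_cocycle])
    and on the fact that, for a bounded symmetric operator X, three conditions
    are equivalent:
      - the Liapunov equation A X + X A* = - Q,
      - its weak form u'(X x) + u(X x') = - u(Q x) for x, u in D(A* ) with
        x' = A* x and u' = A* u              ([weak_liapunov]),
      - its integrated form X = Q_t + S(t) X S*(t) for all t >= 0
                                             ([integrated_liapunov]).
    From the weak form to the integrated one ([weak_integrated]), the scalar
    function u(S(t) X S*(t) x) + u(Q_t x) is Lipschitz and, by the weak form
    taken at S*(t) x and S*(t) u, has right derivative 0, hence is constant;
    the identity then extends from D(A* ) to the whole dual because D(A* ) separates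
    the points of E and X is symmetric. Differentiating the integrated form at
    t = 0 gives back the weak form ([integrated_weak]). From the weak form to
    the Liapunov equation ([weak_generator]), pairing with D(A* ) shows
    S(t) X x - X x = \int_0^t S(s) w ds with w = - Q x - X A* x, so that X x
    is in D(A) and A X x = w.

    If X is a positive symmetric solution, then X - Q_t = S(t) X S*(t) is positive,
    so <Q_t x, x> increases with t and stays below <X x, x>; this is also the
    minimality statement. The increments D = Q_t - Q_s are positive and bounded
    by X, and the Cauchy-Schwarz inequality for D gives
      |D x|^2 <= |X| <D x, x>,
    so that Q_t x is even norm-convergent ([integrated_qint_cvg]). Conversely,
    if all the weak limits exist, the limit operator is linear, positive,
    symmetric, therefore bounded by the uniform boundedness principle on the
    dual ([symmetric_linear_bounded]); letting t tend to infinity in the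
    identity for Q_(t+h) yields the integrated form, hence a solution.

    Behind this stand several facts that are proved first: the Hahn-Banach theorem
    (from minimal sublinear functionals), the completeness of the dual, the Riesz
    representation that defines i*, and the Bochner integrability of
    s |-> S(s) Q S*(s) x. The latter is the delicate point: the orbit of x
    under S* is only weak*-continuous, so that i* S*(s) x is merely weakly
    continuous in H. A Gram-Schmidt sequence built on countably many of its values approximates it
    pointwise by continuous functions ([covariance_path_approximable]). Every
    identity between vector integrals is then checked by pairing with
    functionals ([vint_dual]), which reduces it to real integrals. *)

(** * Bounded operators and functionals *)

Section bounded_operators_complements.
Context {R : realType} {E F : normedModType R}.
Implicit Types (f g : bop E F).

Lemma bopBE f g x : (f - g) x = f x - g x. Proof. by []. Qed.

Lemma bop_ext f g : (forall x, f x = g x) -> f = g.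
Proof. by move=> fg; apply/val_inj/funext. Qed.

Lemma bop_norm f x : `|f x| <= `|f| * `|x|.
Proof. exact: opnorm_le. Qed.

Lemma bop_norm_le f C : 0 <= C -> (forall x, `|f x| <= C * `|x|) -> `|f| <= C.
Proof.
move=> C0 fC; apply: opnorm_lub => x x1.
by rewrite (le_trans (fC x))// ler_piMr.
Qed.

Lemma linear_bounded_cont (f : E -> F) (C : R) :
  linear f -> (forall x, `|f x| <= C * `|x|) -> continuous f.
Proof.
move=> lf fC.
pose g : {linear E -> F} := HB.pack f (GRing.isLinear.Build _ _ _ _ f lf).
apply: (@bounded_linear_continuous _ _ _ g).
apply/linear_boundedP; near=> r => x /=.
by rewrite (le_trans (fC x))// ler_wpM2r//; near: r; apply: nbhs_pinfty_ge; exact: num_real.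
Unshelve. all: by end_near. Qed.

Lemma bop_of (f : E -> F) (C : R) :
  linear f -> (forall x, `|f x| <= C * `|x|) ->
  {g : bop E F | forall x, g x = f x}.
Proof.
move=> lf fC.
have fP : f \in @bop_pred R E F.
  by apply/asboolP; split => //; exact: linear_bounded_cont fC.
by exists (Bop fP).
Qed.

Lemma linear_cont_bounded (f : E -> F) : linear f -> continuous f ->
  exists2 C : R, 0 <= C & forall x, `|f x| <= C * `|x|.
Proof.
move=> lf cf.
have fP : f \in @bop_pred R E F by apply/asboolP.
by exists `|Bop fP| => // x; exact: (bop_norm (Bop fP)).
Qed.

Lemma bop_cvg (f : bop E F) T (G : set_system T) (FG : Filter G) (u : T -> E) (l : E) :
  u @ G --> l -> f (u x) @[x --> G] --> f l.
Proof. exact: (@continuous_cvg T E F G FG u f l (@bop_continuous _ _ _ f l)). Qed.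

End bounded_operators_complements.

(** The algebraic rules below are read in [R], not in its copy [R^o] as a module
    over itself, so that [ring] and [lra] recognize the operations. *)
Section dual_evaluation.
Context {R : realType} {E : normedModType R}.
Implicit Types (u v : dual E) (a : R) (y z : E).

Lemma dualDE u v z : (u + v) z = (u z : R) + v z. Proof. by []. Qed.
Lemma dualBE u v z : (u - v) z = (u z : R) - v z. Proof. by []. Qed.
Lemma dualZE a v z : (a *: v) z = a * (v z : R). Proof. by []. Qed.
Lemma dualD u y z : u (y + z) = (u y : R) + u z. Proof. exact: linearD. Qed.
Lemma dualB u y z : u (y - z) = (u y : R) - u z. Proof. exact: linearB. Qed.
Lemma dualZ u a z : u (a *: z) = a * (u z : R). Proof. exact: linearZ. Qed.

End dual_evaluation.

(** * The Hahn-Banach theorem *)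

Section hahn_banach.
Context {R : realType} {E : normedModType R}.

Definition sublinear (p : E -> R) :=
  (forall x y, p (x + y) <= p x + p y) /\
  (forall (a : R) x, 0 <= a -> p (a *: x) = a * p x).

Lemma sublinear0 p : sublinear p -> p 0 = 0.
Proof. by move=> [_ pZ]; rewrite -(scale0r 0) pZ// mul0r. Qed.

Lemma sublinear_opp p x : sublinear p -> - p (- x) <= p x.
Proof.
move=> sp; rewrite -subr_ge0 opprK.
by rewrite -(sublinear0 sp) -(subrr x); exact: sp.1.
Qed.

Lemma sublinear_ge (p q : E -> R) x : sublinear q ->
  (forall x, q x <= p x) -> - p (- x) <= q x.
Proof.
by move=> sq qp; apply: le_trans (sublinear_opp x sq); rewrite lerN2.
Qed.

(** Sliding [p] along the ray of [e] gives the largest sublinear minorant [q] of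
    [p] with [q (- e) <= - p e]; it is the device that makes a minimal sublinear
    functional odd. *)
Definition sublinear_slide (p : E -> R) (e x : E) : R :=
  inf [set p (x + a *: e) - a * p e | a in [set a | 0 <= a]].

Lemma sublinear_slide_has_inf p e x : sublinear p ->
  has_inf [set p (x + a *: e) - a * p e | a in [set a | 0 <= a]].
Proof.
move=> sp; split; first by exists (p (x + 0 *: e) - 0 * p e), 0 => /=.
exists (- p (- x)) => _ [a /= a0 <-].
rewrite lerBrDl -(sp.2 a e a0).
rewrite lerBlDr.
by rewrite (le_trans _ (sp.1 _ _))// (addrC x) addrK.
Qed.

Lemma sublinear_slide_le p e a x : sublinear p -> 0 <= a ->
  sublinear_slide p e x <= p (x + a *: e) - a * p e.
Proof.
move=> sp a0; apply: ge_inf; first by have [] := sublinear_slide_has_inf e x sp.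
by exists a.
Qed.

Lemma sublinear_slide_lel p e x : sublinear p -> sublinear_slide p e x <= p x.
Proof.
move=> sp; apply: (le_trans (sublinear_slide_le e x sp (lexx 0))).
by rewrite scale0r addr0 mul0r subr0.
Qed.

Lemma sublinear_slide_sublinear p e : sublinear p -> sublinear (sublinear_slide p e).
Proof.
move=> sp.
have Z (a : R) x : 0 < a -> sublinear_slide p e (a *: x) <= a * sublinear_slide p e x.
  move=> a0; rewrite -ler_pdivrMl//; apply: lb_le_inf.
    by have [] := sublinear_slide_has_inf e x sp.
  move=> _ [b /= b0 <-]; rewrite ler_pdivrMl//.
  have ab0 : 0 <= a * b by rewrite mulr_ge0// ltW.
  apply: (le_trans (sublinear_slide_le e (a *: x) sp ab0)).
  by rewrite mulrBr -(sp.2 a (x + b *: e) (ltW a0)) scalerDr scalerA mulrA.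
split=> [x y|a x].
  rewrite -lerBlDr; apply: lb_le_inf.
    by have [] := sublinear_slide_has_inf e x sp.
  move=> _ [a /= a0 <-]; rewrite lerBlDr -lerBlDl; apply: lb_le_inf.
    by have [] := sublinear_slide_has_inf e y sp.
  move=> _ [b /= b0 <-]; rewrite lerBlDr.
  apply: (le_trans (sublinear_slide_le e (x + y) sp (addr_ge0 a0 b0))).
  rewrite scalerDl addrACA mulrDl opprD.
  have := sp.1 (x + a *: e) (y + b *: e); lra.
rewrite le_eqVlt => /predU1P[<-|a0].
  rewrite scale0r mul0r; apply/eqP; rewrite eq_le; apply/andP; split.
    by rewrite -(sublinear0 sp); exact: sublinear_slide_lel.
  apply: lb_le_inf; first by have [] := sublinear_slide_has_inf e 0 sp.
  by move=> _ [b /= b0 <-]; rewrite add0r sp.2// subrr.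
apply/eqP; rewrite eq_le Z//=.
have := Z a^-1 (a *: x); rewrite invr_gt0 => /(_ a0).
by rewrite scalerA mulVf ?gt_eqF// scale1r ler_pdivlMl//.
Qed.

(** By Zorn's lemma: the infimum of a chain of sublinear functionals below [p] is
    finite, since each of them is at least [- p (- x)] at [x], and it is
    subadditive because two members of a chain are comparable. *)
Lemma minimal_sublinear (p : E -> R) : sublinear p ->
  exists q, [/\ sublinear q, (forall x, q x <= p x) &
    forall r, sublinear r -> (forall x, r x <= q x) -> r = q].
Proof.
move=> sp.
pose T := {q : E -> R | sublinear q /\ forall x, q x <= p x}.
pose Rel (s t : T) := `[< forall x, sval t x <= sval s x >].
have [| | | |[q [sq qp]] qmin] := @Zorn T Rel.
- by move=> t; apply/asboolP.
- move=> r s t /asboolP rs /asboolP st; apply/asboolP => x.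
  exact: le_trans (rs x).
- move=> [s sP] [t tP] /asboolP/= st /asboolP/= ts; apply/eq_exist/funext => x.
  by apply/eqP; rewrite eq_le ts st.
- move=> A totA; have [[a0 Aa0]|A0] := pselect (exists a, A a); last first.
    have pT : sublinear p /\ forall x, p x <= p x by split.
    by exists (exist _ p pT) => s As; exfalso; apply: A0; exists s.
  pose B x := [set sval s x | s in A].
  have Binf x : has_inf (B x).
    split; first by exists (sval a0 x), a0.
    exists (- p (- x)) => _ [[s [ss sp']] As <-] /=; exact: sublinear_ge.
  pose q x := inf (B x).
  have qle s x : A s -> q x <= sval s x.
    by move=> As; apply: ge_inf; [have [] := Binf x|exists s].
  have leinf x c : (forall s, A s -> c <= sval s x) -> c <= q x.
    move=> cs; apply: lb_le_inf; first by have [] := Binf x.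
    by move=> _ [s As <-]; exact: cs.
  have qD x y : q (x + y) <= q x + q y.
    rewrite -lerBlDr; apply: (leinf) => s As.
    rewrite lerBlDr -lerBlDl; apply: (leinf) => t At; rewrite lerBlDr.
    have [/asboolP st|/asboolP ts] := totA s t As At.
      apply: (le_trans (qle t _ At)).
      have := (svalP t).1.1 x y; have := st x; lra.
    apply: (le_trans (qle s _ As)).
    have := (svalP s).1.1 x y; have := ts y; lra.
  have qZ (a : R) x : 0 <= a -> q (a *: x) = a * q x.
    rewrite le_eqVlt => /predU1P[<-|a0']; last first.
      apply/eqP; rewrite eq_le; apply/andP; split.
        rewrite -ler_pdivrMl//; apply: (leinf) => s As; rewrite ler_pdivrMl//.
        by rewrite -((svalP s).1.2 _ _ (ltW a0')); exact: qle.
      apply: (leinf) => s As; rewrite ((svalP s).1.2 _ _ (ltW a0')) ler_pM2l//; exact: qle.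
    rewrite scale0r mul0r; apply/eqP; rewrite eq_le; apply/andP; split.
      by rewrite -(sublinear0 (svalP a0).1); exact: qle.
    by apply: (leinf) => s As; rewrite (sublinear0 (svalP s).1).
  have qP : sublinear q /\ forall x, q x <= p x.
    by split => // x; apply: le_trans (qle a0 x Aa0) _; exact: (svalP a0).2.
  exists (exist _ q qP) => s As; apply/asboolP => x /=; exact: qle.
exists q; split => // r sr rq.
have rP : sublinear r /\ forall x, r x <= p x.
  by split => // x; apply: le_trans (rq x) (qp x).
by have := qmin (exist _ r rP); move=> /(_ _)/(congr1 sval)/= ->//; apply/asboolP.
Qed.

(** A minimal sublinear functional equals all its slides, which forces
    [q (- x) = - q x]; an odd sublinear functional is linear. Working with total
    functionals spares the usual extension of partially defined ones. *)
Lemma sublinear_minorant (p : E -> R) : sublinear p ->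
  exists f : E -> R, [/\ forall x y, f (x + y) = f x + f y,
    forall a x, f (a *: x) = a * f x & forall x, f x <= p x].
Proof.
move=> /minimal_sublinear[q [sq qp qmin]].
have qN x : q (- x) = - q x.
  apply/eqP; rewrite eq_le; apply/andP; split; last first.
    by rewrite lerNl; exact: sublinear_opp.
  (* Minimality of [q] applied to its slide along [x]. *)
have slideq : sublinear_slide q x = q.
    by apply: qmin (sublinear_slide_sublinear x sq) _ => y; exact: sublinear_slide_lel.
  have := sublinear_slide_le x (- x) sq ler01.
  by rewrite slideq scale1r addNr mul1r (sublinear0 sq) sub0r.
exists q; split=> // [x y|a x].
  apply/eqP; rewrite eq_le sq.1/=.
  have := sq.1 (x + y) (- y); rewrite addrK qN; lra.
have [a0|a0] := leP 0 a; first exact: sq.2.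
have na0 : 0 <= - a by rewrite oppr_ge0 ltW.
by rewrite -[a]opprK scaleNr qN (sq.2 _ _ na0) opprK mulNr opprK.
Qed.

(** Any linear functional below the slide of the norm along [e] works: the slide
    is below the norm and at most [- `|e|] at [- e]. *)
Lemma norming_functional (e : E) :
  exists y : dual E, (forall x, `|y x| <= `|x|) /\ y e = `|e|.
Proof.
have sn : sublinear (fun x : E => `|x|).
  split=> [x y|a x a0]; first exact: ler_normD.
  by rewrite normrZ ger0_norm.
have [f [fD fZ fp]] := sublinear_minorant (sublinear_slide_sublinear e sn).
have fN x : f (- x) = - f x by rewrite -scaleN1r fZ mulN1r.
have fle x : f x <= `|x|.
  by apply: (le_trans (fp x)); exact: sublinear_slide_lel.
have fnorm x : `|f x| <= `|x|.
  by rewrite ler_norml fle andbT lerNl -fN (le_trans (fle _))// normrN.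
have fnorm1 x : `|f x| <= 1 * `|x| by rewrite mul1r.
have flin : linear (f : E -> R^o) by move=> a x y; rewrite fD fZ.
have [y yf] := bop_of (E := E) (F := R^o) flin fnorm1.
exists y; split=> [x|]; first by rewrite yf.
apply/eqP; rewrite yf eq_le fle/=.
have := le_trans (fp (- e)) (sublinear_slide_le e (- e) sn ler01).
by rewrite scale1r addNr normr0 sub0r mul1r fN lerN2.
Qed.

Lemma dual_sep (a b : E) : (forall y : dual E, y a = y b) -> a = b.
Proof.
move=> ab; apply/eqP; rewrite -subr_eq0 -normr_le0.
have [y [_ <-]] := norming_functional (a - b).
by rewrite linearB/= ab subrr.
Qed.

Lemma dual_norm_le (a : E) (C : R) :
  (forall y : dual E, (forall x, `|y x| <= `|x|) -> y a <= C) -> `|a| <= C.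
Proof. by have [y [yn <-]] := norming_functional a; apply. Qed.

End hahn_banach.

(** * Completeness of the dual and bounded symmetric operators *)

Section bop_complete.
Context {R : realType} {E : normedModType R} {F : completeNormedModType R}.

(** The limit is taken pointwise; one Cauchy ball bounds it, and closed balls
    being stable under pointwise limits turns this into norm convergence. *)
Lemma bop_complete (G : set_system (bop E F)) :
  ProperFilter G -> cauchy G -> cvg G.
Proof.
move=> PG /cauchyP cG.
have cG' (e : R) : 0 < e -> exists f0, \forall f \near G, `|f0 - f| <= e.
  move=> /cG[f0 Gf0]; exists f0; apply: filterS Gf0 => f.
  by rewrite -ball_normE /= => /ltW.
have cpt x : cvg ((fun f : bop E F => f x) @ G).
  apply: cauchy_cvg; apply: cauchy_exP => e e0.
  have e1 : 0 < e / (`|x| + 1) by rewrite divr_gt0// ltr_wpDl.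
  have [f0 Gf0] := cG' _ e1; exists (f0 x).
  rewrite /fmapE; apply: filterS Gf0 => f ff0.
  rewrite -ball_normE /= -bopBE (le_lt_trans (bop_norm _ _))//.
  rewrite (le_lt_trans (ler_wpM2r _ ff0))// mulrAC -mulrA gtr_pMr//.
  by rewrite ltr_pdivrMr ?mul1r ?ltrDl// ltr_wpDl.
pose l x : F := lim ((fun f : bop E F => f x) @ G).
have lx x : (fun f : bop E F => f x) @ G --> l x by exact: cpt.
have llin : linear l.
  move=> a x y; apply: (cvg_unique _ (lx _)) => //.
  have -> : (fun f : bop E F => f (a *: x + y)) = (fun f => a *: f x + f y).
    by apply/funext => f; rewrite linearP.
  by apply: cvgD; [apply: cvgZl_tmp|]; exact: lx.
have lclose f0 e x : (\forall f \near G, `|f0 - f| <= e) ->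
    `|f0 x - l x| <= e * `|x|.
  move=> Gf0; apply/ler_addgt0Pr => d d0.
  have /cvgrPdist_le/(_ d d0) := lx x => Gd.
  near G => f.
  have ff0 : `|f0 - f| <= e by near: f.
  have fd : `|l x - f x| <= d by near: f.
  rewrite (le_trans (ler_distD (f x) _ _))// lerD//; last by rewrite distrC.
  by rewrite -bopBE (le_trans (bop_norm _ _))// ler_wpM2r.
have [f1 Gf1] := cG' 1 ltr01.
have lbnd x : `|l x| <= (1 + `|f1|) * `|x|.
  rewrite -[l x](subrK (f1 x)) (le_trans (ler_normD _ _))// mulrDl lerD//.
    by rewrite distrC; exact: lclose.
  exact: bop_norm.
have [L Ll] := bop_of llin lbnd.
apply: (@cvgP _ _ L); apply/cvgrPdist_le => e e0.
have e20 : 0 < e / 2 by rewrite divr_gt0.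
have [f0 Gf0] := cG' _ e20.
apply: filterS (Gf0) => f ff0.
rewrite (le_trans (ler_distD f0 _ _))// [e]splitr lerD//.
rewrite distrC; apply: bop_norm_le; first exact: ltW.
by move=> x; rewrite bopBE Ll; exact: lclose.
Unshelve. all: by end_near. Qed.

HB.instance Definition _ := Uniform_isComplete.Build (bop E F) bop_complete.

End bop_complete.

Section symmetric_bounded.
Context {R : realType} {E : normedModType R}.

(** For each [y], symmetry makes [x |-> y (X x) = x (X y)] a bounded functional
    of [x]; over the unit ball of the [y] these are pointwise bounded by [`|X x|],
    so Banach-Steinhaus on the dual bounds them uniformly. *)
Lemma symmetric_linear_bounded (X : dual E -> E) : linear X -> symmetric_op X ->
  exists2 C : R, 0 <= C & forall x, `|X x| <= C * `|x|.
Proof.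
move=> lX sX.
pose unit_ball := [set y : dual E | forall z, `|y z| <= `|z|].
pose Fam : set (dual E -> R^o) := [set (fun x => y (X x)) | y in unit_ball].
have [] := @Banach_Steinhauss R (dual E : completeNormedModType R) R^o Fam _ _ 1.
- move=> _ [y yu <-]; split; last by move=> a u v; rewrite lX linearP.
  move=> r; exists (r * `|X y|) => x xr.
  by rewrite sX (le_trans (bop_norm _ _))// ler_wpM2r.
- by move=> x; exists `|X x| => _ [y yu <-]; exact: yu.
move=> M XM.
have {}XM x : `|x| <= 1 -> `|X x| <= M.
  move=> x1; apply: dual_norm_le => y yu.
  by rewrite (le_trans (ler_norm _))//; apply: (XM (fun x => y (X x))) => //; exists y.
exists M; first by apply: le_trans (XM 0 _); rewrite ?normr0.
move=> x; pose Y : {linear dual E -> E} := HB.pack X (GRing.isLinear.Build _ _ _ _ X lX).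
have X0 : X 0 = 0 := linear0 Y.
have XZ a z : X (a *: z) = a *: X z := linearZ_LR Y a z.
have [->|x0] := eqVneq x 0; first by rewrite X0 !normr0 mulr0.
have nx : 0 < `|x| by rewrite normr_gt0.
have := XM (`|x|^-1 *: x); rewrite normrZ normfV normr_id mulVf ?gt_eqF// lexx.
move=> /(_ isT); rewrite XZ normrZ normfV normr_id/=.
by rewrite ler_pdivrMl// mulrC.
Qed.

End symmetric_bounded.

(** * Hilbert space: Riesz representation and Gram-Schmidt projections *)

(** This single quadratic argument serves the Cauchy-Schwarz inequality of the
    inner product, the variational characterization in Riesz's theorem and the
    Cauchy-Schwarz inequality of positive symmetric operators. *)
Lemma discriminant_le (R : realType) (a b c : R) : 0 <= c ->
  (forall t, 0 <= a + 2 * b * t + c * t ^+ 2) -> b ^+ 2 <= a * c.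
Proof.
rewrite le_eqVlt => /predU1P[<-|c0] H.
  rewrite mulr0; have [->|b0] := eqVneq b 0; first by rewrite expr0n.
  have := H (- (a + 1) / (2 * b)).
  rewrite mul0r addr0 mulrC divfK ?mulf_neq0// => ?; lra.
have := H (- b / c).
have -> : a + 2 * b * (- b / c) + c * (- b / c) ^+ 2 = a - b ^+ 2 / c.
  by field; rewrite gt_eqF.
by rewrite subr_ge0 ler_pdivrMr.
Qed.

Lemma cauchy_cvg_dist (R : realType) (V : completeNormedModType R) T
    (G : set_system T) {PG : ProperFilter G} (f : T -> V) :
  (forall e : R, 0 < e -> exists A, G A /\ forall x y, A x -> A y -> `|f x - f y| <= e) ->
  cvg (f @ G).
Proof.
move=> fG; apply: cauchy_cvg; apply: cauchy_exP => e e0.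
have [A [GA Af]] := fG (e / 2) (divr_gt0 e0 (ltr0n _ 2)).
have [x Ax] := filter_ex GA.
exists (f x); apply: (@filterS _ G _ A) => // y Ay.
by rewrite -ball_normE /= (le_lt_trans (Af _ _ Ax Ay))// ltr_pdivrMr// ltr_pMr// ltr1n.
Qed.

Section hilbert.
Context {R : realType} {H : completeNormedModType R} (ip : {dot H for idfun}).
Hypothesis hip : forall h : H, ip h h = `|h| ^+ 2.

Lemma ipC u v : ip u v = ip v u.
Proof. by rewrite hermC expr0 mul1r. Qed.

Lemma ipDl u v w : ip (u + v) w = ip u w + ip v w. Proof. exact: linearDl. Qed.
Lemma ipDr u v w : ip u (v + w) = ip u v + ip u w. Proof. exact: linearDr. Qed.
Lemma ipBl u v w : ip (u - v) w = ip u w - ip v w. Proof. exact: linearBl. Qed.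
Lemma ipBr u v w : ip u (v - w) = ip u v - ip u w. Proof. exact: linearBr. Qed.
Lemma ipZl a u w : ip (a *: u) w = a * ip u w. Proof. exact: linearZl_LR. Qed.
Lemma ipZr a u w : ip u (a *: w) = a * ip u w.
Proof. by rewrite ipC ipZl ipC. Qed.
Lemma ip0l w : ip 0 w = 0. Proof. exact: linear0l. Qed.

Lemma ip_cauchy_schwarz u v : `|ip u v| <= `|u| * `|v|.
Proof.
rewrite -(@ler_pXn2r _ 2)// ?nnegrE ?mulr_ge0// real_normK ?num_real//.
rewrite exprMn; apply: discriminant_le => [|t]; first exact: exprn_ge0.
have -> : `|u| ^+ 2 + 2 * ip u v * t + `|v| ^+ 2 * t ^+ 2 = `|u + t *: v| ^+ 2.
  by rewrite -!hip !(ipDl, ipDr, ipZl, ipZr) (ipC v u); ring.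
exact: exprn_ge0.
Qed.

Lemma ip_continuous (u v : H) {T} (G : set_system T) (FG : Filter G) (f g : T -> H) :
  f @ G --> u -> g @ G --> v -> ip (f x) (g x) @[x --> G] --> (ip u v : R).
Proof.
move=> fu gv.
apply/cvgrPdist_le => e e0.
have lim0 : (`|f x - u| * (`|g x| + 0) + (`|u| * `|g x - v|)) @[x --> G] --> (0 : R).
  rewrite [X in _ --> X](_ : 0 = 0 * (`|v| + 0) + `|u| * 0 :> R); last by lra.
  apply: cvgD; apply: cvgM.
  - by rewrite -(@normr0 _ H) -(subrr u); apply: cvg_norm; apply: cvgB => //; exact: cvg_cst.
  - by apply: cvgD; [exact: cvg_norm|exact: cvg_cst].
  - exact: cvg_cst.
  - by rewrite -(@normr0 _ H) -(subrr v); apply: cvg_norm; apply: cvgB => //; exact: cvg_cst.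
have /cvgrPdist_le/(_ e e0) := lim0.
apply: filterS => x; rewrite sub0r normrN => xe.
apply: le_trans xe; rewrite addr0 [leRHS]ger0_norm ?addr_ge0// ?mulr_ge0//.
rewrite distrC (_ : _ - _ = ip (f x - u) (g x) + ip u (g x - v)); last first.
  by rewrite ipBl ipBr; ring.
by rewrite (le_trans (ler_normD _ _))// lerD// ip_cauchy_schwarz.
Qed.


(** The representative minimizes [J h = `|h| ^+ 2 - 2 * phi h]: the parallelogram
    identity makes minimizing sequences Cauchy, and the minimality of [J] at [h]
    along every line through [h] gives [ip h g = phi g]. *)
Lemma riesz_representation (phi : dual H) : exists h, forall g, ip h g = phi g.
Proof.
pose J h : R := `|h| ^+ 2 - 2 * phi h.
have hasinf : has_inf (range J).
  split; first by exists (J 0), 0.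
  exists (- `|phi| ^+ 2) => _ [h _ <-]; rewrite /J.
  have := bop_norm phi h; have := ler_norm (phi h).
  have := sqr_ge0 (`|h| - `|phi|); rewrite /GRing.scale/=; nra.
pose m := inf (range J).
have mJ h : m <= J h by apply: ge_inf; [exact: hasinf.2|exists h].
(* The parallelogram identity, with [J] at the midpoint bounded below by [m]. *)
have parallelogram u v : `|u - v| ^+ 2 <= 2 * (J u - m) + 2 * (J v - m).
  have phiE : phi (2^-1 *: (u + v)) = 2^-1 * (phi u + phi v) :> R.
    by rewrite linearZ/= linearD.
  have := mJ (2^-1 *: (u + v)); rewrite /J -!hip phiE.
  rewrite !(ipBl, ipBr, ipDl, ipDr, ipZl, ipZr) (ipC v u); lra.
have seqex n : exists h, J h < m + n.+1%:R^-1.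
  have n0 : 0 < n.+1%:R^-1 :> R by rewrite invr_gt0.
  by have [_ [h _ <-] Jh] := inf_adherent n0 hasinf; exists h.
have {seqex} [u Ju] := choice seqex.
have harm0 : n.+1%:R^-1 @[n --> \oo] --> (0 : R) := @cvg_harmonic R.
have : cvg (u @ \oo).
  apply: cauchy_cvg_dist => e e0.
  have e20 : 0 < e ^+ 2 / 4 by rewrite divr_gt0// exprn_gt0.
  exists [set n | n.+1%:R^-1 <= e ^+ 2 / 4]; split.
    have /cvgrPdist_le/(_ _ e20) := harm0; apply: filterS => n.
    by rewrite sub0r normrN ger0_norm// invr_ge0.
  move=> n k /= ne ke; rewrite -(@ler_pXn2r _ 2)// ?nnegrE ?(ltW e0)//.
  move: ne ke (Ju n) (Ju k) (parallelogram (u n) (u k)).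
  move: (J (u n)) (J (u k)) n.+1%:R^-1 k.+1%:R^-1 => a b c d; lra.
move=> /cvg_ex[h uh]; exists h.
have Jh : J h <= m.
  apply: (@ler_cvg_to _ \oo _ R (fun n => ip (u n) (u n) - 2 * phi (u n)) (fun n => m + n.+1%:R^-1)).
  - rewrite /J -hip; apply: cvgB; first exact: ip_continuous.
    by apply: cvgMl_tmp; exact: bop_cvg.
  - by rewrite -[X in _ --> X]addr0; apply: cvgD; [exact: cvg_cst|exact: harm0].
  - by near=> n; rewrite hip; exact/ltW/Ju.
move=> g; apply/eqP; rewrite -subr_eq0 -sqrf_eq0 eq_le sqr_ge0 andbT.
rewrite -(mul0r (`|g| ^+ 2)); apply: discriminant_le => [|t]; first exact: exprn_ge0.
have phiE : phi (h + t *: g) = phi h + t * phi g :> R.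
  by rewrite linearD/= linearZ.
have := mJ (h + t *: g); have := Jh.
rewrite /J -!hip phiE !(ipDl, ipDr, ipZl, ipZr) (ipC g h).
rewrite expr2; nra.
Unshelve. all: by end_near. Qed.

(** As [0^-1 = 0], the zero vector is sent to itself, so that linearly dependent
    vectors need no special case in the orthonormalization below. *)
Definition normalize (v : H) : H := `|v|^-1 *: v.

(** The orthogonal projection onto the span of the first [n] terms of [q]. The
    orthonormalized vectors and the projections are produced by one recursion:
    the next vector is what the current projection leaves of [q k]. *)
Fixpoint gs_proj (q : nat -> H) (n : nat) (h : H) : H :=
  if n is k.+1 then
    let e := normalize (q k - gs_proj q k (q k)) in
    gs_proj q k h + ip h e *: e
  else 0.

Definition gs_vec (q : nat -> H) (n : nat) : H :=
  normalize (q n - gs_proj q n (q n)).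

Lemma gs_projS q n h :
  gs_proj q n.+1 h = gs_proj q n h + ip h (gs_vec q n) *: gs_vec q n.
Proof. by []. Qed.

Lemma gs_proj_linear q n a u v :
  gs_proj q n (a *: u + v) = a *: gs_proj q n u + gs_proj q n v.
Proof.
elim: n => [|n IH]; first by rewrite /= scaler0 addr0.
rewrite !gs_projS IH; move: (gs_vec q n) => e; rewrite ipDl ipZl.
by rewrite scalerDl scalerDr -scalerA addrACA.
Qed.

Lemma gs_projB q n u v : gs_proj q n (u - v) = gs_proj q n u - gs_proj q n v.
Proof. by rewrite addrC -scaleN1r gs_proj_linear scaleN1r addrC. Qed.

Lemma gs_projZ q n a u : gs_proj q n (a *: u) = a *: gs_proj q n u.
Proof.
have := gs_proj_linear q n a u 0.
by rewrite addr0 => ->; rewrite -(subrr (0 : H)) gs_projB subrr addr0.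
Qed.

Lemma gs_proj_sym q n u v : ip (gs_proj q n u) v = ip u (gs_proj q n v).
Proof.
elim: n => [|n IH]; first by rewrite /= ip0l ipC ip0l.
rewrite !gs_projS; move: (gs_vec q n) => e.
by rewrite ipDl ipDr IH ipZl ipZr (ipC e v) mulrC.
Qed.

Lemma normalizeK v : ip v (normalize v) *: normalize v = v.
Proof.
rewrite /normalize ipZr hip scalerA expr2.
have [->|v0] := eqVneq v 0; first by rewrite scaler0.
by rewrite mulrA mulVf ?normr_eq0// mul1r mulfV ?normr_eq0// scale1r.
Qed.

Lemma normalize_idem v : ip (normalize v) (normalize v) *: normalize v = normalize v.
Proof.
have [->|v0] := eqVneq v 0; first by rewrite /normalize !scaler0.
rewrite -[RHS]scale1r; congr (_ *: _).
rewrite /normalize ipZl ipZr hip expr2 mulrA mulrACA.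
by rewrite mulVf ?normr_eq0// mulr1.
Qed.

Lemma gs_projK q n u : gs_proj q n (gs_proj q n u) = gs_proj q n u.
Proof.
elim: n u => [//|n IH] u.
have Pe : gs_proj q n (gs_vec q n) = 0.
  by rewrite /gs_vec /normalize gs_projZ gs_projB IH subrr scaler0.
have ee : ip (gs_vec q n) (gs_vec q n) *: gs_vec q n = gs_vec q n.
  exact: normalize_idem.
rewrite !gs_projS; move: (gs_vec q n) Pe ee => e Pe ee.
rewrite (addrC (gs_proj q n u)) gs_proj_linear Pe scaler0 add0r IH ipDl.
by rewrite gs_proj_sym Pe (ipC u 0) ip0l addr0 ipZl -scalerA ee addrC.
Qed.

Lemma gs_vec_proj q n u : ip (gs_proj q n u) (gs_vec q n) = 0.
Proof.
rewrite gs_proj_sym /gs_vec /normalize gs_projZ gs_projB gs_projK subrr scaler0.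
by rewrite ipC ip0l.
Qed.

Lemma gs_proj_leq q n m u : (n <= m)%N -> gs_proj q m (gs_proj q n u) = gs_proj q n u.
Proof.
move=> /subnK <-; elim: (m - n)%N => [|k IH]; first by rewrite gs_projK.
by rewrite addSn gs_projS IH -IH gs_vec_proj scale0r addr0.
Qed.

Lemma gs_proj_mem q n : gs_proj q n.+1 (q n) = q n.
Proof.
rewrite gs_projS /gs_vec.
have -> : ip (q n) (normalize (q n - gs_proj q n (q n))) =
    ip (q n - gs_proj q n (q n)) (normalize (q n - gs_proj q n (q n))).
  by rewrite ipBl (gs_vec_proj q n (q n)) subr0.
by rewrite normalizeK addrC subrK.
Qed.

Lemma gs_proj_pythagoras q n m u : (n <= m)%N ->
  `|gs_proj q m u - gs_proj q n u| ^+ 2 = `|gs_proj q m u| ^+ 2 - `|gs_proj q n u| ^+ 2.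
Proof.
move=> nm; rewrite -!hip !(ipBl, ipBr).
have -> : ip (gs_proj q m u) (gs_proj q n u) = ip (gs_proj q n u) (gs_proj q n u).
  by rewrite gs_proj_sym gs_proj_leq// [RHS]gs_proj_sym gs_projK.
have -> : ip (gs_proj q n u) (gs_proj q m u) = ip (gs_proj q n u) (gs_proj q n u).
  by rewrite ipC gs_proj_sym gs_proj_leq// [RHS]gs_proj_sym gs_projK.
by lra.
Qed.

Lemma gs_proj_norm q n u : `|gs_proj q n u| <= `|u|.
Proof.
rewrite -(@ler_pXn2r _ 2)// ?nnegrE//.
have : 0 <= `|u - gs_proj q n u| ^+ 2 by exact: exprn_ge0.
rewrite -!hip !(ipBl, ipBr) (ipC (gs_proj q n u) u).
have -> : ip u (gs_proj q n u) = ip (gs_proj q n u) (gs_proj q n u).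
  by rewrite [RHS]gs_proj_sym gs_projK.
lra.
Qed.

(** The squared norms of the projections increase and are bounded by that of [u],
    so by Pythagoras the projections are Cauchy. If [p] is their limit, [u - p] is
    orthogonal to each [q k], hence to [u] by hypothesis, and also to [p], hence
    it vanishes. The hypothesis says that [u] lies in the closed span of [q], in
    a form that weak continuity can provide. *)
Lemma gs_proj_cvg q u :
  (forall v, (forall k, ip (q k) v = 0) -> ip u v = 0) ->
  gs_proj q n u @[n --> \oo] --> u.
Proof.
move=> uq.
have nd : nondecreasing_seq (fun n => `|gs_proj q n u| ^+ 2).
  by move=> n m nm; rewrite -subr_ge0 -gs_proj_pythagoras// exprn_ge0.
have : cvg ((fun n => `|gs_proj q n u| ^+ 2) @ \oo).
  apply: nondecreasing_is_cvgn => //; exists (`|u| ^+ 2) => _ [n _ <-].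
  by rewrite ler_pXn2r// ?nnegrE// gs_proj_norm.
move=> /cvg_ex[l nl].
have : cvg ((fun n => gs_proj q n u) @ \oo).
  apply: cauchy_cvg_dist => e e0.
  have e20 : 0 < e ^+ 2 / 2 by rewrite divr_gt0// exprn_gt0.
  exists [set n | `|l - `|gs_proj q n u| ^+ 2| <= e ^+ 2 / 2]; split.
    by have /cvgrPdist_le/(_ _ e20) := nl.
  move=> n m; wlog nm : n m / (n <= m)%N.
    move=> wl An Am; have [nm|/ltnW mn] := leqP n m; first exact: wl.
    by rewrite distrC; exact: wl.
  rewrite /= !ler_norml => /andP[n1 n2] /andP[m1 m2].
  rewrite distrC -(@ler_pXn2r _ 2)// ?nnegrE ?(ltW e0)// gs_proj_pythagoras//.
  by move: n1 n2 m1 m2; move: (`|gs_proj q n u| ^+ 2) (`|gs_proj q m u| ^+ 2) => a b; lra.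
move=> /cvg_ex[p up].
have orth_q k : ip (q k) (u - p) = 0.
  have : ip (q k) (u - gs_proj q n u) @[n --> \oo] --> ip (q k) (u - p).
    by apply: ip_continuous; [exact: cvg_cst|apply: cvgB => //; exact: cvg_cst].
  move=> /(@cvg_lim _ (@Rhausdorff R)) <-; apply: (@cvg_lim _ (@Rhausdorff R)) => //.
  apply: cvg_near_cst; near=> n; rewrite ipBr -gs_proj_sym.
  have kn : (k < n)%N by near: n; exact: nbhs_infty_gt.
  by rewrite -{2}[q k](gs_proj_mem q k) gs_proj_leq// gs_proj_mem subrr.
have orth_p : ip p (u - p) = 0.
  have orth_n n : ip (gs_proj q n u) (u - p) = 0.
    have : ip (gs_proj q n u) (u - gs_proj q m u) @[m --> \oo] --> ip (gs_proj q n u) (u - p).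
      by apply: ip_continuous; [exact: cvg_cst|apply: cvgB => //; exact: cvg_cst].
    move=> /(@cvg_lim _ (@Rhausdorff R)) <-; apply: (@cvg_lim _ (@Rhausdorff R)) => //.
    apply: cvg_near_cst; near=> m; rewrite ipBr -gs_proj_sym.
    have nm : (n <= m)%N by near: m; exact: nbhs_infty_ge.
    by rewrite gs_proj_leq// subrr.
  have : ip (gs_proj q n u) (u - p) @[n --> \oo] --> ip p (u - p).
    by apply: ip_continuous; [exact: up|exact: cvg_cst].
  under eq_fun do rewrite orth_n.
  by move=> /(@cvg_lim _ (@Rhausdorff R)) <-; rewrite lim_cst.
suff up_eq : u = p by rewrite [X in _ --> X]up_eq.
apply/eqP; rewrite -subr_eq0 -normr_eq0 -sqrf_eq0 -hip ipBl orth_p.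
by rewrite (uq _ orth_q) subrr.
Unshelve. all: by end_near. Qed.

End hilbert.

(** * Bochner integration of bounded limits of simple functions *)

Section simple_functions.
Context d (T : measurableType d) (R : realType) (E : normedModType R).
Implicit Types (s : @simple_function d T R E) (D A : set T).

Lemma sf_nil : exists s, forall x, sf_eval s x = 0.
Proof.
exists (@SimpleFunction d T R E 0 (fun=> set0) (fun=> 0) (fun=> measurable0)) => x.
by rewrite /sf_eval big_ord0.
Qed.

Lemma sf_add s A c : measurable A ->
  exists s', forall x, sf_eval s' x = sf_eval s x + (\1_A x : R) *: c.
Proof.
move=> mA; pose n := sf_size s.
pose A' (k : 'I_n.+1) := if unlift ord_max k is Some j then @sf_set _ _ _ _ s j else A.
pose c' (k : 'I_n.+1) := if unlift ord_max k is Some j then @sf_val _ _ _ _ s j else c.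
have mA' k : measurable (A' k).
  by rewrite /A'; case: unlift => // j; exact: sf_measurable.
exists (SimpleFunction c' mA') => x.
rewrite /sf_eval/= big_ord_recr/= /A' /c' unlift_none; congr (_ + _).
apply: eq_bigr => i _.
have -> : widen_ord (leqnSn n) i = lift ord_max i.
  by apply: val_inj; rewrite /= /bump leqNgt ltn_ord.
by rewrite liftK.
Qed.

(** The uniform bound lets dominated convergence turn pointwise convergence into
    convergence of integrals on a set of finite measure. *)
Definition simply_approximable D (f : T -> E) :=
  exists (s : nat -> @simple_function d T R E) (C : R),
    (forall n x, D x -> `|sf_eval (s n) x| <= C) /\
    (forall x, D x -> sf_eval (s n) x @[n --> \oo] --> f x).

(** A substitute for measurability of vector-valued functions that needs no Borel
    structure on [E]: it passes to pointwise limits, and adding a simple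
    function preserves it since the translation by [e] is built in. *)
Definition norm_measurable D (f : T -> E) :=
  forall e : E, measurable_fun D (fun x => `|e + f x|).

Lemma norm_measurable_indic D f A c : measurable A -> norm_measurable D f ->
  norm_measurable D (fun x => f x + (\1_A x : R) *: c).
Proof.
move=> mA mf e.
have -> : (fun x => `|e + (f x + (\1_A x : R) *: c)|) =
    (fun x => \1_A x * `|(e + c) + f x| + (1 - \1_A x) * `|e + f x|).
  apply/funext => x; rewrite indicE; case: (x \in A) => /=.
    by rewrite scale1r mul1r subrr mul0r addr0 -addrA (addrC c).
  by rewrite scale0r addr0 mul0r add0r subr0 mul1r.
apply: measurable_funD; apply: measurable_funM.
- exact: measurable_indic.
- exact: mf.
- by apply: measurable_funB; [exact: measurable_cst|exact: measurable_indic].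
- exact: mf.
Qed.

Lemma norm_measurable_sum D f n (A : 'I_n -> set T) (c : 'I_n -> E) :
  (forall k, measurable (A k)) -> norm_measurable D f ->
  norm_measurable D (fun x => f x + \sum_(k < n) (\1_(A k) x : R) *: c k).
Proof.
move=> mA; elim: (index_enum _) f => [|k r IH] f mf.
  by under [X in norm_measurable _ X]funext do rewrite big_nil addr0.
under [X in norm_measurable _ X]funext do rewrite big_cons addrA.
by apply: IH; exact: norm_measurable_indic.
Qed.

Lemma norm_measurable_cst D c : norm_measurable D (fun=> c).
Proof. by move=> e; exact: measurable_cst. Qed.

Lemma norm_measurableB D f s : norm_measurable D f ->
  norm_measurable D (fun x => f x - sf_eval s x).
Proof.
move=> mf.
have -> : (fun x => f x - sf_eval s x) =
    (fun x => f x + \sum_(k < sf_size s) (\1_(sf_set k) x : R) *: - sf_val k).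
  apply/funext => x; rewrite /sf_eval -sumrN; congr (_ + _).
  by apply: eq_bigr => k _; rewrite scalerN.
by apply: norm_measurable_sum => // k; exact: sf_measurable.
Qed.

Lemma norm_measurable_sf D s : norm_measurable D (sf_eval s).
Proof.
have -> : sf_eval s = (fun x => 0 + \sum_(k < sf_size s) (\1_(sf_set k) x : R) *: sf_val k).
  by apply/funext => x; rewrite add0r.
apply: norm_measurable_sum; last exact: norm_measurable_cst.
by move=> k; exact: sf_measurable.
Qed.

Lemma norm_measurable_approx D f : simply_approximable D f -> norm_measurable D f.
Proof.
move=> [s [C [_ sf]]] e; apply: (measurable_fun_cvg (h := fun n x => `|e + sf_eval (s n) x|)).
  by move=> n; exact: norm_measurable_sf.
by move=> x Dx; apply: cvg_norm; apply: cvgD; [exact: cvg_cst|exact: sf].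
Qed.

Lemma dual_sf (y : dual E) s x :
  y (sf_eval s x) = \sum_(k < sf_size s) (\1_(sf_set k) x : R) * y (sf_val k).
Proof. by rewrite linear_sum/=; apply: eq_bigr => k _; rewrite linearZ. Qed.

Lemma measurable_dual_sf D (y : dual E) s : measurable_fun D (fun x => y (sf_eval s x) : R).
Proof.
under eq_fun do rewrite dual_sf.
apply: measurable_sum => k; apply: measurable_funM; last exact: measurable_cst.
by apply: measurable_indic; exact: sf_measurable.
Qed.

Lemma measurable_dual D (y : dual E) f : simply_approximable D f ->
  measurable_fun D (fun x => y (f x) : R).
Proof.
move=> [s [C [_ sf]]].
apply: (measurable_fun_cvg (h := fun n x => y (sf_eval (s n) x) : R)).
  by move=> n; exact: measurable_dual_sf.
by move=> x Dx; exact: bop_cvg (sf x Dx).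
Qed.

Lemma simply_approximable_bop D f (B : bop E E) : simply_approximable D f ->
  simply_approximable D (fun x => B (f x)).
Proof.
move=> [s [C [sC sf]]].
pose s' n := SimpleFunction (fun k => B (@sf_val _ _ _ _ (s n) k)) (@sf_measurable _ _ _ _ (s n)).
have s'E n x : sf_eval (s' n) x = B (sf_eval (s n) x).
  by rewrite /sf_eval linear_sum/=; apply: eq_bigr => k _; rewrite linearZ.
exists s', (`|B| * C); split=> [n x Dx|x Dx].
  by rewrite s'E (le_trans (bop_norm _ _))// ler_wpM2l// sC.
by under eq_fun do rewrite s'E; apply: bop_cvg; exact: sf.
Qed.

Lemma approximable_bounded D f : simply_approximable D f ->
  exists2 C : R, 0 <= C & forall x, D x -> `|f x| <= C.
Proof.
move=> [s [C [sC sf]]]; exists `|C| => // x Dx.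
apply: (cvgr_to_le (cvg_norm (sf x Dx))).
by apply: nearW => n; rewrite (le_trans (sC n x Dx))// ler_norm.
Qed.

Lemma sf_bounded s : exists C : R, forall x, `|sf_eval s x| <= C.
Proof.
exists (\sum_(k < sf_size s) `|sf_val k|) => x; rewrite /sf_eval.
apply: (le_trans (ler_norm_sum _ _ _)); apply: ler_sum => k _.
rewrite normrZ ler_piMl// indicE; case: (_ \in _) => /=.
  by rewrite normr1.
by rewrite normr0.
Qed.

End simple_functions.

Section bochner_dual.
Context d (T : measurableType d) (R : realType) (E : completeNormedModType R).
Variables (mu : {measure set T -> \bar R}) (D : set T).
Hypotheses (mD : measurable D) (muD : (mu D < +oo)%E).
Implicit Types (s : @simple_function d T R E) (f : T -> E) (y : dual E).

Lemma bounded_integrable (g : T -> R) C : measurable_fun D g ->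
  (forall x, D x -> `|g x| <= C) -> mu.-integrable D (EFin \o g).
Proof.
move=> mg gC; apply: measurable_bounded_integrable => //.
exists C; split; first exact: num_real.
by move=> M /ltW CM x Dx /=; exact: le_trans (gC _ Dx) CM.
Qed.

Lemma integrable_indic_cst A c : measurable A ->
  mu.-integrable D (EFin \o (fun x => (\1_A x : R) * c)).
Proof.
move=> mA; apply: (@bounded_integrable _ `|c|).
  by apply: measurable_funM; [exact: measurable_indic|exact: measurable_cst].
move=> x _; rewrite normrM ler_piMl// indicE; case: (_ \in _) => /=.
  by rewrite normr1.
by rewrite normr0.
Qed.

Lemma Rintegral_indic_cst A c : measurable A ->
  \int[mu]_(x in D) ((\1_A x : R) * c) = fine (mu (D `&` A)) * c.
Proof.
move=> mA; rewrite RintegralZr//; last first.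
  have := integrable_indic_cst 1 mA.
  by apply: eq_integrable => // x _ /=; rewrite mulr1.
by rewrite /Rintegral integral_indic// setIC.
Qed.

Lemma dual_sf_integral y s :
  y (sf_integral mu D s) = \int[mu]_(x in D) (y (sf_eval s x) : R).
Proof.
rewrite /sf_integral linear_sum/=.
under eq_Rintegral do rewrite dual_sf.
suff [_ ->] : mu.-integrable D (EFin \o (fun x =>
    \sum_(k < sf_size s) (\1_(sf_set k) x : R) * y (sf_val k))) /\
   \int[mu]_(x in D) (\sum_(k < sf_size s) (\1_(sf_set k) x : R) * y (sf_val k)) =
   \sum_(k < sf_size s) fine (mu (D `&` sf_set k)) * y (sf_val k).
  by apply: eq_bigr => k _; rewrite linearZ.
elim: (index_enum _) => [|k r [IH1 IH2]].
  split.
    apply: (@eq_integrable _ _ _ mu _ _ (fun=> 0%E)) => //; last exact: integrable0.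
    by move=> x _ /=; rewrite big_nil.
  under eq_Rintegral do rewrite big_nil.
  by rewrite big_nil Rintegral_cst// mul0r.
have ik := integrable_indic_cst (y (sf_val k)) (@sf_measurable _ _ _ _ s k).
split.
  have := integrableD mD ik IH1.
  by apply: eq_integrable => // x _ /=; rewrite big_cons EFinD.
under eq_Rintegral do rewrite big_cons.
rewrite RintegralD// IH2 big_cons Rintegral_indic_cst//.
exact: sf_measurable.
Qed.

Variable f : T -> E.
Hypothesis af : simply_approximable D f.

Lemma dual_integrable y : mu.-integrable D (EFin \o (fun x => y (f x) : R)).
Proof.
have [C C0 fC] := approximable_bounded af.
apply: (@bounded_integrable _ (`|y| * C)); first exact: measurable_dual.
by move=> x Dx; rewrite (le_trans (bop_norm _ _))// ler_wpM2l// fC.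
Qed.

Lemma dual_sf_integrable y s : mu.-integrable D (EFin \o (fun x => y (sf_eval s x) : R)).
Proof.
have [C fC] := sf_bounded s.
apply: (@bounded_integrable _ (`|y| * C)); first exact: measurable_dual_sf.
by move=> x Dx; rewrite (le_trans (bop_norm _ _))// ler_wpM2l// fC.
Qed.

Lemma err_measurable s : measurable_fun D (fun x => `|f x - sf_eval s x|).
Proof.
have := norm_measurableB s (norm_measurable_approx af) 0.
by under eq_fun do rewrite add0r.
Qed.

Lemma err_integrable s : mu.-integrable D (EFin \o (fun x => `|f x - sf_eval s x|)).
Proof.
have [C C0 fC] := approximable_bounded af.
have [C' fC'] := sf_bounded s.
apply: (@bounded_integrable _ (C + C')); first exact: err_measurable.
move=> x Dx; rewrite normr_id (le_trans (ler_normB _ _))// lerD//.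
exact: fC.
Qed.

(** Pairing with [y] compares the integral of a simple function with the real
    integral of [y \o f]; this estimate yields at once the convergence of the
    integrals of the approximations and the value of the limit. *)
Lemma dual_sf_integral_err y s :
  `|y (sf_integral mu D s) - \int[mu]_(x in D) (y (f x) : R)| <=
  `|y| * \int[mu]_(x in D) `|f x - sf_eval s x|.
Proof.
rewrite dual_sf_integral.
have i1 := dual_sf_integrable y s; have i2 := dual_integrable y.
have i3 : mu.-integrable D (EFin \o (fun x => y (sf_eval s x) - y (f x) : R)).
  by have := integrableB mD i1 i2; apply: eq_integrable.
rewrite -RintegralB//; apply: (le_trans (le_normr_Rintegral mD i3)).
rewrite -RintegralZl//; last exact: err_integrable.
apply: le_Rintegral => //.
- by have := integrable_norm i3; apply: eq_integrable.
- by have := integrableZl mD `|y| (err_integrable s); apply: eq_integrable.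
- by move=> x _; rewrite -linearB distrC bop_norm.
Qed.

(** Any witness of Bochner integrability gives the same pairings, so the value
    chosen by [xget] does not matter. *)
Lemma is_bochner_integral_dual v y : is_bochner_integral mu D f v ->
  y v = \int[mu]_(x in D) (y (f x) : R).
Proof.
move=> [s [_ _ err0 sv]].
have yv : y (sf_integral mu D (s n)) @[n --> \oo] --> y v by exact: bop_cvg.
apply: (cvg_unique _ yv) => //.
have {}err0 : \int[mu]_(x in D) `|f x - sf_eval (s n) x| @[n --> \oo] --> 0 by exact: (fine_cvg err0).
have b0 : `|y| * \int[mu]_(x in D) `|f x - sf_eval (s n) x| @[n --> \oo] --> (0 : R).
  by rewrite -(mulr0 `|y|); apply: cvgMl_tmp; exact: err0.
apply/cvgrPdist_le => e e0; have /cvgrPdist_le/(_ e e0) := b0.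
apply: filterS => n; rewrite sub0r normrN distrC => h.
by rewrite (le_trans (dual_sf_integral_err _ _))// (le_trans _ h)// ler_norm.
Qed.

(** Dominated convergence makes the approximations converge to [f] in the mean;
    their integrals are then Cauchy, because the norm in [E] is the supremum of
    pairings. *)
Lemma is_bochner_integral_ex : exists v, is_bochner_integral mu D f v.
Proof.
have [s [C [sC sf]]] := af; have [C' C'0 fC'] := approximable_bounded af.
have err0 : (\int[mu]_(x in D) `|f x - sf_eval (s n) x|%:E)%E @[n --> \oo] --> 0%E.
  have [|||||_ _] := @dominated_convergence _ _ _ mu D mD
     (fun n x => `|f x - sf_eval (s n) x|%:E) (fun=> 0%E) (fun=> (C + C')%:E).
  - by move=> n; apply/measurable_EFinP; exact: err_measurable.
  - exact: measurable_cst.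
  - apply: aeW => x Dx; apply: cvg_EFin; first by apply: nearW.
    rewrite [X in X @ _ --> _](_ : _ = (fun n => `|f x - sf_eval (s n) x|)); last by apply/funext.
    rewrite -(@normr0 _ E) -(subrr (f x)); apply: cvg_norm; apply: cvgB; [exact: cvg_cst|exact: sf].
  - by apply: (@bounded_integrable (fun=> C + C') `|C + C'|) => //; exact: measurable_cst.
  - apply: aeW => x n Dx; rewrite gee0_abs ?lee_fin// (addrC C).
    by rewrite (le_trans (ler_normB _ _))// lerD ?fC' ?sC.
  - by rewrite integral0.
have err0' : \int[mu]_(x in D) `|f x - sf_eval (s n) x| @[n --> \oo] --> 0 by exact: (fine_cvg err0).
have : cvg (sf_integral mu D (s n) @[n --> \oo]).
  apply: cauchy_cvg_dist => e e0; have e20 : 0 < e / 2 by rewrite divr_gt0.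
  exists [set n | \int[mu]_(x in D) `|f x - sf_eval (s n) x| <= e / 2]; split.
    have /cvgrPdist_le/(_ _ e20) := err0'; apply: filterS => n.
    by rewrite sub0r normrN => h /=; rewrite (le_trans _ h)// ler_norm.
  move=> n m /= ne me; apply: dual_norm_le => y yu.
  have y1 : `|y| <= 1 by apply: bop_norm_le => // x; rewrite mul1r.
  have bound k : \int[mu]_(x in D) `|f x - sf_eval (s k) x| <= e / 2 ->
      `|y (sf_integral mu D (s k)) - \int[mu]_(x in D) (y (f x) : R)| <= e / 2.
    move=> ke; rewrite (le_trans (dual_sf_integral_err _ _))// (le_trans _ ke)//.
    by rewrite ler_piMl//; exact: Rintegral_ge0.
  rewrite linearB/= (le_trans (ler_norm _))//.
  rewrite (le_trans (ler_distD (\int[mu]_(x in D) (y (f x) : R)) _ _))//.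
  rewrite [e in leRHS]splitr; apply: lerD; first exact: bound.
  by rewrite distrC; exact: bound.
move=> /cvg_ex[v sv]; exists v, s; split => //.
- move=> n k; apply: le_lt_trans muD; apply: le_measure => //; rewrite ?inE//.
  by apply: measurableI => //; exact: sf_measurable.
- exact: aeW.
Qed.

Theorem bochner_integral_dual y :
  y (bochner_integral mu D f) = \int[mu]_(x in D) (y (f x) : R).
Proof.
apply: is_bochner_integral_dual.
have := is_bochner_integral_ex => -[v fv].
by apply: xgetPex; exists v.
Qed.

End bochner_dual.

(** * Functions on an interval *)

Section real_line.
Context {R : realType}.

(** The supremum of the points of [[0, t]] where [P] holds satisfies [P] by the
    left-limit hypothesis, and the step hypothesis forbids it to be less than
    [t]. *)
Lemma real_induction (P : R -> Prop) (t : R) : 0 <= t -> P 0 ->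
  (forall a, 0 <= a < t -> P a -> exists b, a < b <= t /\ P b) ->
  (forall c, 0 < c <= t ->
    (forall e : R, 0 < e -> exists a, [/\ 0 <= a, c - e < a < c & P a]) -> P c) ->
  P t.
Proof.
move=> t0 P0 step lim.
pose A := [set a | 0 <= a <= t /\ P a].
have A0 : A 0 by split => //; rewrite lexx.
have At : ubound A t by move=> a [/andP[]].
have supA : has_sup A by split; [exists 0|exists t].
pose c := sup A.
have c0 : 0 <= c by apply: ub_le_sup => //; exists t.
have ct : c <= t by apply: ge_sup => //; exists 0.
have Pc : P c.
  have [//|nPc] := pselect (P c).
  have {}c0 : 0 < c.
    by rewrite lt_neqAle c0 andbT; apply/eqP => c0'; apply: nPc; rewrite -c0'.
  apply: lim => [|e e0]; first by rewrite c0.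
  have [a [/andP[a0 at_] Pa] ca] := sup_adherent e0 supA.
  exists a; split => //; rewrite ca/= lt_neqAle; apply/andP; split.
    by apply/eqP => ac; apply: nPc; rewrite -ac.
  by apply: ub_le_sup; [exists t|split => //; rewrite a0].
move: ct; rewrite le_eqVlt => /predU1P[<- //|ct].
have [|b [/andP[cb bt] Pb]] := step c _ Pc; first by rewrite c0.
have : b <= c by apply: ub_le_sup; [exists t|split => //; rewrite bt (le_trans c0)// ltW].
by rewrite leNgt cb.
Qed.

Lemma lebesgue_measure_itv0 (t : R) : 0 <= t ->
  (lebesgue_measure `[0%R, t] = t%:E)%E.
Proof.
move=> t0; rewrite lebesgue_measure_itv/= lte_fin.
by move: t0; rewrite le_eqVlt => /predU1P[<-|->]; rewrite ?ltxx// oppr0 adde0.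
Qed.

Context {E : normedModType R}.
Local Notation TR := (measurableTypeR R).

Definition continuous_on (t : R) (F : R -> E) :=
  forall x, 0 <= x <= t -> F y @[y --> within `[0, t] (nbhs x)] --> F x.

Lemma continuous_on_dist t F (e : R) x : continuous_on t F -> 0 < e -> 0 <= x <= t ->
  exists2 r : R, 0 < r & forall y, 0 <= y <= t -> `|x - y| < r -> `|F x - F y| <= e.
Proof.
move=> cF e0 xt; have /cvgrPdist_le/(_ e e0) := cF x xt.
rewrite near_withinE => -[r /= r0 rF]; exists r => // y yt xy.
by apply: rF => //=; rewrite in_itv.
Qed.

(** Real induction on the right end point: a step function that is
    [e]-close to [F] up to [a] and vanishes afterwards is extended by a constant
    step, to the right of [a] or up to [c], by continuity at that point. *)
Lemma continuous_on_simple t F (e : R) : 0 <= t -> continuous_on t F -> 0 < e ->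
  exists s : @simple_function _ TR R E, forall x, 0 <= x <= t -> `|F x - sf_eval s x| <= e.
Proof.
move=> t0 cF e0.
pose P a := exists s : @simple_function _ TR R E,
  (forall x, 0 <= x <= a -> `|F x - sf_eval s x| <= e) /\
  (forall x, a < x -> sf_eval s x = 0).
have extend a b v : a <= b -> P a -> (forall x, a < x <= b -> `|F x - v| <= e) -> P b.
  move=> ab [s [sF s0]] vF.
  have mab : measurable (`]a, b]%classic : set TR) by exact: measurable_itv.
  have [s' s'E] := sf_add s v mab.
  exists s'; split=> x; rewrite s'E indicE.
    move=> /andP[x0 xb]; have [xa|ax] := leP x a.
      by rewrite memNset/= ?in_itv/= ?ltNge ?xa//= scale0r addr0 sF// x0.
    by rewrite mem_set/= ?in_itv/= ?ax//= scale1r s0// add0r vF// ax.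
  move=> bx; rewrite memNset/= ?in_itv/=; last by rewrite (leNgt x) bx andbF.
  by rewrite scale0r addr0 s0// (le_lt_trans ab).
suff [s [sF _]] : P t by exists s.
apply: real_induction => //.
- have [s sE] := @sf_nil _ TR R E.
  have m00 : measurable (`[0, 0]%classic : set TR) by exact: measurable_itv.
  have [s' s'E] := sf_add s (F 0) m00.
  exists s'; split=> x; rewrite s'E sE add0r indicE.
    rewrite -eq_le => /eqP <-; rewrite mem_set/= ?in_itv/= ?lexx//.
    by rewrite scale1r subrr normr0 ltW.
  by move=> x0; rewrite memNset/= ?scale0r// in_itv/= (leNgt x) x0 andbF.
- move=> a /andP[a0 at_] Pa.
  have [|r r0 rF] := continuous_on_dist (x := a) cF e0; first by rewrite a0 ltW.
  exists (Num.min t (a + r / 2)).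
  have ar : a < a + r / 2 by rewrite ltrDl divr_gt0.
  split; first by rewrite lt_min at_ ar ge_min lexx.
  apply: (extend a _ (F a)) => //; first by rewrite le_min !ltW.
  move=> x /andP[ax]; rewrite le_min => /andP[xt xr].
  rewrite distrC rF//; first by rewrite xt (le_trans a0)// ltW.
  rewrite ler0_norm; last by rewrite subr_le0 ltW.
  rewrite opprB ltrBlDl (le_lt_trans xr)// ltrD2l.
  by rewrite ltr_pdivrMr// ltr_pMr// ltr1n.
- move=> c /andP[c0 ct] Pc.
  have [|r r0 rF] := continuous_on_dist (x := c) cF e0; first by rewrite ct ltW.
  have [a [a0 /andP[cra ac] Pa]] := Pc _ r0.
  apply: (extend a _ (F c)) => //; first exact: ltW.
  move=> x /andP[ax xc]; rewrite distrC rF//.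
    by rewrite (le_trans xc ct) (le_trans a0)// ltW.
  by rewrite ger0_norm ?subr_ge0// ltrBlDr -ltrBlDl (lt_trans cra).
Qed.

Lemma approximable_continuous_limit t (F : nat -> R -> E) (f : R -> E) (C : R) :
  0 <= t -> (forall n, continuous_on t (F n)) ->
  (forall n x, 0 <= x <= t -> `|F n x| <= C) ->
  (forall x, 0 <= x <= t -> F n x @[n --> \oo] --> f x) ->
  @simply_approximable _ TR R E `[0, t]%classic f.
Proof.
move=> t0 cF FC Ff.
have sP n : exists s : @simple_function _ TR R E,
    forall x, 0 <= x <= t -> `|F n x - sf_eval s x| <= n.+1%:R^-1.
  by apply: continuous_on_simple => //; rewrite invr_gt0.
have [s sF] := choice sP.
exists s, (C + 1); split=> [n x|x]; rewrite /= in_itv/= => xt.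
  rewrite -[sf_eval _ _](subrK (F n x)) addrC (le_trans (ler_normD _ _))// lerD ?FC//.
  by rewrite distrC (le_trans (sF n x xt))// invf_le1// ler1n.
have harm0 : n.+1%:R^-1 @[n --> \oo] --> (0 : R) := @cvg_harmonic R.
apply: (cvg_sub0 _ (Ff x xt)); apply: norm_cvg0.
apply/cvgrPdist_le => e e0; have /cvgrPdist_le/(_ e e0) := harm0.
apply: filterS => n; rewrite !sub0r !normrN normr_id => he.
rewrite distrC (le_trans (sF n x xt))// (le_trans _ he)// ler_norm//.
Qed.

Lemma approximable_continuous t (f : R -> E) : 0 <= t -> continuous_on t f ->
  @simply_approximable _ TR R E `[0, t]%classic f.
Proof.
move=> t0 cf.
have [s sf] := continuous_on_simple t0 cf ltr01.
have [C sC] := sf_bounded s.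
apply: (@approximable_continuous_limit t (fun=> f) f (1 + C)) => //.
  move=> _ x xt; rewrite -[f x](subrK (sf_eval s x)).
  by rewrite (le_trans (ler_normD _ _))// lerD// sf.
by move=> x _; exact: cvg_cst.
Qed.

End real_line.

(** * Vector-valued integrals on [0, t] *)

Section translation.
Context {R : realType}.
Local Notation TR := (measurableTypeR R).
Local Notation leb := (@lebesgue_measure R).

(** The translated measure gives half-open intervals their length, which
    characterizes Lebesgue measure. *)
Lemma lebesgue_measure_translation (h : R) (A : set TR) : measurable A ->
  lebesgue_measure A = lebesgue_measure ((fun x : R => x + h) @^-1` A).
Proof.
have mh : measurable_fun setT (fun x : TR => (x + h : TR)).
  by apply: measurable_funD => //; exact: measurable_cst.
move=> mA.
apply: (@lebesgue_measure_unique R (pushforward leb (fun x : TR => (x + h : TR)))) => //.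
move=> _ [[a b] _ <-] /=; rewrite /pushforward.
have -> : (fun x : R => x + h) @^-1` `]a, b]%classic = `]a - h, b - h]%classic.
  by apply/seteqP; split=> x /=; rewrite !in_itv/= ltrBlDr lerBrDr.
rewrite !lebesgue_measure_itv/= !lte_fin ltrD2r.
by case: ifPn => // _; rewrite -!EFinD opprB addrA subrK.
Qed.

Lemma Rintegral_translation (h t : R) (k : R -> R) : 0 <= t ->
  leb.-integrable `[h, t + h] (EFin \o k) ->
  \int[leb]_(x in `[h, t + h]) k x = \int[leb]_(x in `[0, t]) k (x + h).
Proof.
move=> t0 ik.
have mh : measurable_fun setT (fun x : TR => (x + h : TR)).
  by apply: measurable_funD => //; exact: measurable_cst.
have mD : measurable (`[h, t + h]%classic : set TR) by exact: measurable_itv.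
pose phi (x : TR) : TR := x + h.
have preD : phi @^-1` `[h, t + h]%classic = `[0, t]%classic.
  by apply/seteqP; split=> x /=; rewrite /phi !in_itv/= lerDr lerD2r.
have pushE : forall f : TR -> \bar R,
    (\int[pushforward leb phi]_(x in `[h, (t + h)%R]) f x =
     \int[leb]_(x in `[h, (t + h)%R]) f x)%E.
  move=> f; apply: eq_measure_integral => A mA _.
  by rewrite [RHS](lebesgue_measure_translation h).
pose g := (EFin \o k) \_ `[h, t + h].
have ig : leb.-integrable setT g by apply/(integrable_mkcond _ mD).
have mg : measurable_fun setT g by exact: (measurable_int leb).
have igphi : leb.-integrable (phi @^-1` `[h, t + h]%classic) (g \o phi).
  apply/integrableP; split.
    by apply: measurable_funTS; exact: measurableT_comp.
  have mabsg : measurable_fun `[h, t + h]%classic (abse \o g).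
    by apply: measurable_funTS; exact: measurableT_comp.
  have absg0 : {in `[h, t + h]%classic, forall y, (0 <= (abse \o g) y)%E} by move=> y _ /=.
  have -> : (\int[leb]_(x in phi @^-1` `[h, (t + h)%R]) `|(g \o phi) x|)%E =
      (\int[pushforward leb phi]_(y in `[h, (t + h)%R]) (abse \o g) y)%E.
    by rewrite (ge0_integral_pushforward mh leb mD mabsg absg0).
  rewrite pushE; have /integrableP[_ igoo] := ig.
  apply: le_lt_trans igoo; apply: ge0_subset_integral => //; last by move=> x _ /=; exact: abse_ge0.
  exact: measurableT_comp.
rewrite /Rintegral; congr fine.
transitivity (\int[leb]_(x in `[h, (t + h)%R]) g x)%E.
  by apply: eq_integral => x xD; rewrite /g patchE xD.
rewrite -pushE integral_pushforward// preD; apply: eq_integral => x xD.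
rewrite /= /g patchE ifT//; move: xD.
by rewrite -preD !inE.
Qed.

End translation.

(** Locked: the integral is only used through its pairings, [vint_dual]. *)
HB.lock Definition vint (R : realType) (E : completeNormedModType R) (t : R)
  (f : R -> E) : E := bochner_integral lebesgue_measure `[0, t] f.

Section vector_integral.
Context {R : realType} {E : completeNormedModType R}.
Local Notation TR := (measurableTypeR R).
Local Notation leb := (@lebesgue_measure R).
Implicit Types (f g : R -> E) (t h : R) (y : dual E).

Definition loc_approximable f := forall t, 0 <= t ->
  @simply_approximable _ TR R E `[0, t]%classic f.

Lemma measurable_itv0 t : measurable (`[0, t]%classic : set TR).
Proof. exact: measurable_itv. Qed.

Lemma lebesgue_itv0_fin t : 0 <= t -> (leb `[0%R, t]%classic < +oo)%E.
Proof. by move=> t0; rewrite lebesgue_measure_itv0// ltey. Qed.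

Lemma vint_dual t f y : loc_approximable f -> 0 <= t ->
  y (vint t f) = \int[leb]_(s in `[0, t]) (y (f s) : R).
Proof.
move=> af t0; rewrite vint.unlock; apply: bochner_integral_dual; [exact: measurable_itv0| |exact: af].
exact: lebesgue_itv0_fin.
Qed.

Lemma loc_integrable t f y : loc_approximable f -> 0 <= t ->
  leb.-integrable `[0, t] (EFin \o (fun s => y (f s) : R)).
Proof.
move=> af t0; apply: dual_integrable; [exact: measurable_itv0| |exact: af].
exact: lebesgue_itv0_fin.
Qed.

Lemma Rintegral_itv0_cst t (c : R) : 0 <= t ->
  \int[leb]_(s in `[0, t]) c = c * t.
Proof.
move=> t0; rewrite Rintegral_cst; last exact: measurable_itv0.
exact: (congr1 (fun z => c * fine z) (lebesgue_measure_itv0 t0)).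
Qed.

Lemma cst_integrable t (c : R) : 0 <= t -> leb.-integrable `[0, t] (EFin \o (fun=> c)).
Proof.
move=> t0; apply: (@bounded_integrable _ _ _ _ _ (measurable_itv0 t) (lebesgue_itv0_fin t0) _ `|c|) => //.
Qed.

Lemma vint_dist t f (c : E) (e : R) : loc_approximable f -> 0 <= t ->
  (forall s, 0 <= s <= t -> `|f s - c| <= e) -> `|vint t f - t *: c| <= e * t.
Proof.
move=> af t0 fe; apply: dual_norm_le => y yu.
have iy := loc_integrable y af t0; have iyc := cst_integrable (y c : R) t0.
rewrite linearB linearZ/= vint_dual// -[_ *: _]mulrC.
have mt := measurable_itv0 t.
rewrite -(Rintegral_itv0_cst (y c) t0) -RintegralB//.
rewrite -(Rintegral_itv0_cst e t0); apply: le_Rintegral.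
- exact: measurable_itv0.
- by have := integrableB (measurable_itv0 t) iy iyc; apply: eq_integrable => //; exact: measurable_itv0.
- exact: cst_integrable.
- move=> s /=; rewrite in_itv/= => st.
  by rewrite -linearB (le_trans (ler_norm _))// (le_trans (yu _))// fe.
Qed.

Lemma vint_norm t f (C : R) : loc_approximable f -> 0 <= t ->
  (forall s, 0 <= s <= t -> `|f s| <= C) -> `|vint t f| <= C * t.
Proof.
move=> af t0 fC; rewrite -[vint t f]subr0 -(scaler0 _ t); apply: vint_dist => //.
by move=> s st; rewrite subr0 fC.
Qed.

Lemma vint_linear t f g k (a : R) :
  loc_approximable f -> loc_approximable g -> loc_approximable k -> 0 <= t ->
  (forall s, 0 <= s <= t -> k s = a *: f s + g s) ->
  vint t k = a *: vint t f + vint t g.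
Proof.
move=> af ag ak t0 kE; apply: dual_sep => y.
rewrite linearP/= (vint_dual y af t0) (vint_dual y ag t0) (vint_dual y ak t0).
rewrite -[_ *: _]/(_ * _) -RintegralZl; [|exact: measurable_itv0|exact: loc_integrable].
have mt := measurable_itv0 t.
rewrite -RintegralD//; last 2 first.
- by have := integrableZl mt a (loc_integrable y af t0); apply: eq_integrable.
- exact: loc_integrable.
by apply: eq_Rintegral => s; rewrite inE/= in_itv/= => st; rewrite kE// linearP.
Qed.

Lemma vint_bop t f g (B : bop E E) : loc_approximable f -> loc_approximable g -> 0 <= t ->
  (forall s, 0 <= s <= t -> g s = B (f s)) -> vint t g = B (vint t f).
Proof.
move=> af ag t0 gE; apply: dual_sep => y.
rewrite -[RHS]/(bop_adjoint B y (vint t f)).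
rewrite (vint_dual y ag t0) (vint_dual _ af t0).
by apply: eq_Rintegral => s; rewrite inE/= in_itv/= => st; rewrite gE.
Qed.

Lemma vint_shift t h f g : loc_approximable f -> loc_approximable g -> 0 <= t -> 0 <= h ->
  (forall s, 0 <= s <= t -> g s = f (s + h)) ->
  vint (t + h) f = vint h f + vint t g.
Proof.
move=> af ag t0 h0 gE; apply: dual_sep => y.
have th0 : 0 <= t + h by rewrite addr_ge0.
rewrite linearD/= (vint_dual y af th0) (vint_dual y af h0) (vint_dual y ag t0).
have ith := loc_integrable y af th0.
have mh : measurable (`[h, t + h]%classic : set TR) by exact: measurable_itv.
have ihth : leb.-integrable `[h, t + h] (EFin \o (fun s => y (f s) : R)).
  apply: integrableS ith => //.
  by move=> s /=; rewrite !in_itv/= => /andP[hs ->]; rewrite andbT (le_trans h0).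
have := @Rintegral_itvB R (fun s => y (f s)) (BLeft 0) (BRight (t + h)) h ith.
rewrite !bnd_simp h0 lerDr t0 => /(_ isT isT)/(canRL (subrK _)) ->.
rewrite [LHS]addrC; congr (_ + _).
rewrite Rintegral_itv_obnd_cbnd; last first.
  apply: integrableS ihth => //.
  by move=> s /=; rewrite !in_itv/= => /andP[/ltW -> ->].
rewrite Rintegral_translation//.
by apply: eq_Rintegral => s; rewrite inE/= in_itv/= => st; rewrite gE.
Qed.

(** The mean of [f] over [[0, h]] differs from [f 0] by at most the oscillation of
    [f] on that interval. *)
Lemma vint_average f : loc_approximable f -> f s @[s --> 0^'+] --> f 0 ->
  h^-1 *: vint h f @[h --> 0^'+] --> f 0.
Proof.
move=> af f0; apply/cvgrPdist_le => e e0.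
have /cvgrPdist_le/(_ e e0) := f0.
rewrite near_withinE => -[r /= r0 rF]; near=> h.
have h0 : 0 < h by near: h; exact: nbhs_right_gt.
have hr : h < r by near: h; exact: nbhs_right_lt.
have : `|vint h f - h *: f 0| <= e * h.
  apply: vint_dist => //.
  move=> s /andP[s0 sh].
  move: s0; rewrite le_eqVlt => /predU1P[<-|s0].
    by rewrite subrr normr0 ltW.
  rewrite distrC; apply: rF => //=.
  by rewrite sub0r normrN gtr0_norm// (le_lt_trans sh).
rewrite distrC -ler_pdivrMr// => /(le_trans _); apply.
have -> : f 0 - h^-1 *: vint h f = - (h^-1 *: (vint h f - h *: f 0)).
  by rewrite scalerBr scalerA mulVf ?gt_eqF// scale1r opprB.
by rewrite normrN normrZ gtr0_norm ?invr_gt0// distrC mulrC distrC.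
Unshelve. all: by end_near. Qed.

Lemma vint0 f : loc_approximable f -> vint 0 f = 0.
Proof.
move=> af; have [C C0 fC] := approximable_bounded (af 0 (lexx 0)).
have := @vint_norm 0 f C af (lexx 0).
rewrite mulr0 normr_le0 => h0; apply/eqP; apply: h0 => s s0.
by apply: fC; rewrite /= in_itv.
Qed.

End vector_integral.

(** * Semigroups, their generators and adjoint generators *)

Section semigroup_theory.
Context {R : realType} {E : completeNormedModType R} (S : R -> bop E E).
Hypothesis hS : C0_semigroup S.
Implicit Types (x z : E) (s t h : R) (u v y : dual E).

Lemma sg0 x : S 0 x = x. Proof. by have [] := hS. Qed.

Lemma sgD s t x : 0 <= s -> 0 <= t -> S (s + t) x = S s (S t x).
Proof. by have [_ + _] := hS; exact. Qed.

Lemma sg_cvg0 x : S t x @[t --> 0^'+] --> x. Proof. by have [_ _] := hS; exact. Qed.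

Lemma sgC s t x : 0 <= s -> 0 <= t -> S s (S t x) = S t (S s x).
Proof. by move=> s0 t0; rewrite -!sgD// addrC. Qed.

Lemma sg_near0 x (e : R) : 0 < e ->
  exists2 r : R, 0 < r & forall s, 0 <= s < r -> `|S s x - x| <= e.
Proof.
move=> e0; have /cvgrPdist_le/(_ e e0) := @sg_cvg0 x.
rewrite near_withinE => -[r /= r0 rF]; exists r => // s /andP[s0 sr].
move: s0; rewrite le_eqVlt => /predU1P[<-|s0]; first by rewrite sg0 subrr normr0 ltW.
by rewrite distrC; apply: rF => //=; rewrite sub0r normrN gtr0_norm.
Qed.

(** Otherwise there are times [u n] tending to [0] with [`|S (u n)|] unbounded,
    whereas [S (u n) x] tends to [x] for each [x]; this contradicts
    Banach-Steinhaus. *)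
Lemma sg_bounded_near0 : exists2 d : R, 0 < d &
  exists2 M : R, 0 <= M & forall s, 0 <= s <= d -> `|S s| <= M.
Proof.
apply: contrapT => nb.
have uP (n : nat) : exists s, 0 <= s <= n.+1%:R^-1 /\ n%:R < `|S s|.
  apply: contrapT => nu; apply: nb; exists n.+1%:R^-1; first by rewrite invr_gt0.
  exists n%:R => // s sn; rewrite leNgt; apply/negP => ns; apply: nu.
  by exists s.
have {uP} [u uP] := choice uP.
pose F : set (E -> E) := range (fun n => S (u n) : E -> E).
have [] := @Banach_Steinhauss R E E F _ _ 1.
- move=> _ [n _ <-]; split; last exact: bop_linear.
  by move=> r; exists (`|S (u n)| * r) => x xr; rewrite (le_trans (bop_norm _ _))// ler_wpM2l.
- move=> x; have [r r0 rx] := sg_near0 x ltr01.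
  have [N rN] : exists N : nat, N.+1%:R^-1 < r.
    have [N _ /(_ N (leqnn N))] := near_infty_natSinv_lt (PosNum r0); by exists N.
  exists (`|x| + 1 + \sum_(n < N) `|S (u n) x|) => _ [n _ <-].
  have [nN|Nn] := ltnP n N.
    rewrite (bigD1 (Ordinal nN))//= addrCA lerDl addr_ge0// ?addr_ge0//.
    exact: sumr_ge0.
  rewrite -[S _ x](subrK x) (le_trans (ler_normD _ _))// addrC -addrA lerD2l.
  rewrite (le_trans (rx _ _))//; last by rewrite lerDl sumr_ge0.
  have [/andP[-> un] _] := uP n; rewrite /= (le_lt_trans un)// (le_lt_trans _ rN)//.
  by rewrite lef_pV2 ?posrE// ler_nat.
move=> M FM.
have SM n : `|S (u n)| <= M.
  by apply: opnorm_lub => x x1; apply: (FM (S (u n))) => //; exists n.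
have := SM (Num.truncn M).+1; have [_] := uP (Num.truncn M).+1.
move=> /lt_le_trans /[apply] /lt_trans => /(_ _ (truncnS_gt M)).
by rewrite ltxx.
Qed.

Lemma sg_bounded t : exists2 M : R, 0 <= M &
  forall s, 0 <= s <= t -> forall x, `|S s x| <= M * `|x|.
Proof.
have [d d0 [M M0 dM]] := sg_bounded_near0.
have bound n : exists2 K : R, 0 <= K & forall s, 0 <= s <= d *+ n -> `|S s| <= K.
  elim: n => [|n [K K0 nK]].
    exists M => // s; rewrite mulr0n => /andP[s0 s0']; apply: dM.
    by rewrite s0 (le_trans s0')// ltW.
  exists (K + M * K); first by rewrite addr_ge0// mulr_ge0.
  move=> s /andP[s0]; have [sn _|ns] := leP s (d *+ n).
    by rewrite (le_trans (nK _ _)) ?s0// lerDl mulr_ge0.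
  rewrite mulrS => sn.
  have dn0 : 0 <= d *+ n by rewrite mulrn_wge0// ltW.
  have sd0 : 0 <= s - d *+ n by rewrite subr_ge0 ltW.
  rewrite (@le_trans _ _ (M * K))//; last by rewrite lerDr.
  apply: bop_norm_le => [|x]; first by rewrite mulr_ge0.
  rewrite -[s](subrK (d *+ n)) sgD//.
  rewrite (le_trans (bop_norm _ _))// -mulrA ler_pM//.
    by apply: dM; rewrite sd0 lerBlDr.
  by rewrite (le_trans (bop_norm _ _))// ler_wpM2r// nK// dn0 lexx.
have [N tN] : exists N : nat, t <= d *+ N.
  exists (Num.truncn (t / d)).+1; rewrite -mulr_natr mulrC -ler_pdivrMr//.
  exact/ltW/truncnS_gt.
have [K K0 NK] := bound N; exists K => // s /andP[s0 st] x.
by rewrite (le_trans (bop_norm _ _))// ler_wpM2r// NK// s0 (le_trans st).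
Qed.

Lemma sg_continuous_on t x : continuous_on t (fun s => S s x).
Proof.
have [M M0 SM] := sg_bounded t.
have dist r s : 0 <= r -> r <= s -> s <= t ->
    `|S s x - S r x| <= M * `|S (s - r) x - x|.
  move=> r0 rs st.
  have -> : S s x = S r (S (s - r) x) by rewrite -sgD// ?subr_ge0// addrC subrK.
  by rewrite -linearB SM// r0 (le_trans rs).
move=> s /andP[s0 st]; apply/cvgrPdist_le => e e0.
have eM : 0 < e / (M + 1) by rewrite divr_gt0// ltr_wpDl.
have [r r0 rx] := sg_near0 x eM.
rewrite near_withinE; exists r => //= w /= sw; rewrite in_itv/= => /andP[w0 wt].
have Me : M * (e / (M + 1)) <= e.
  rewrite mulrCA; apply: ler_piMr; first exact: ltW.
  by rewrite ler_pdivrMr ?ltr_wpDl// mul1r lerDl.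
have [ws|/ltW sw'] := leP w s.
  rewrite (le_trans (dist _ _ w0 ws st))// (le_trans _ Me)// ler_wpM2l// rx//.
  by rewrite subr_ge0 ws/= -[ltLHS]ger0_norm ?subr_ge0.
rewrite distrC (le_trans (dist _ _ s0 sw' wt))// (le_trans _ Me)// ler_wpM2l// rx//.
by rewrite subr_ge0 sw'/= -[ltLHS]ger0_norm ?subr_ge0// distrC.
Qed.

Lemma sg_approximable x : loc_approximable (fun s => S s x).
Proof. by move=> t t0; apply: approximable_continuous => //; exact: sg_continuous_on. Qed.

(** The integrated semigroup: it maps [E] into the domain of the generator, and
    its difference quotients at [0] approximate the identity, so it regularizes
    both vectors and, by transposition, functionals. *)
Definition sg_int t x : E := vint t (fun s => S s x).

Lemma sg_int_linear t a x z : 0 <= t -> sg_int t (a *: x + z) = a *: sg_int t x + sg_int t z.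
Proof.
move=> t0; apply: vint_linear => //; try exact: sg_approximable.
by move=> s _; rewrite linearP.
Qed.

Lemma sg_int_norm t (M : R) : (forall s, 0 <= s <= t -> forall x, `|S s x| <= M * `|x|) ->
  0 <= t -> forall x, `|sg_int t x| <= (M * t) * `|x|.
Proof.
move=> SM t0 x; rewrite mulrAC; apply: vint_norm => //; first exact: sg_approximable.
by move=> s st; exact: SM.
Qed.

Lemma sg_int_bop t : 0 <= t -> {J : bop E E | forall x, J x = sg_int t x}.
Proof.
move=> t0; have /cid2[M M0 SM] := sg_bounded t.
apply: (@bop_of _ _ _ _ (M * t)); last exact: sg_int_norm.
by move=> a x z; exact: sg_int_linear.
Qed.

Lemma sg_int_commute t h x : 0 <= t -> 0 <= h -> S h (sg_int t x) = sg_int t (S h x).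
Proof.
move=> t0 h0; apply/esym; apply: vint_bop => //; try exact: sg_approximable.
by move=> s /andP[s0 _]; exact: sgC.
Qed.

(** The two ways of splitting [t + h] in this identity give
    [S h I_t - I_t = S t I_h - I_h] for [I_t := sg_int t], which is what the
    generator property below differentiates. *)
Lemma sg_int_cocycle t h x : 0 <= t -> 0 <= h ->
  sg_int (t + h) x = sg_int h x + S h (sg_int t x).
Proof.
move=> t0 h0; rewrite sg_int_commute//; apply: vint_shift => //; try exact: sg_approximable.
by move=> s /andP[s0 _]; rewrite sgD.
Qed.

Lemma sg_int_average x : h^-1 *: sg_int h x @[h --> 0^'+] --> x.
Proof.
rewrite -[X in _ --> X]sg0.
apply: (@vint_average _ _ (fun s => S s x)); first exact: sg_approximable.
by rewrite sg0; exact: sg_cvg0.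
Qed.

Lemma sg_int_generator t x : 0 <= t -> sg_generator S (sg_int t x) (S t x - x).
Proof.
move=> t0; rewrite /sg_generator.
have lim : S t (h^-1 *: sg_int h x) - h^-1 *: sg_int h x @[h --> 0^'+] --> S t x - x.
  by apply: cvgB; [apply: bop_cvg|]; exact: sg_int_average.
apply: cvg_trans lim; apply: near_eq_cvg; near=> h.
have h0 : 0 <= h by apply: ltW; near: h; exact: nbhs_right_gt.
rewrite linearZ/= -scalerBr; congr (_ *: _).
have e : sg_int h x + S h (sg_int t x) = sg_int t x + S t (sg_int h x).
  by rewrite -!sg_int_cocycle// addrC.
have -> : S h (sg_int t x) = sg_int t x + S t (sg_int h x) - sg_int h x.
  by rewrite -e addrAC subrr add0r.
by rewrite [RHS]addrAC (addrAC (sg_int t x)) subrr add0r.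
Unshelve. all: by end_near. Qed.

(** The bounded operator [sg_int t] commutes with the difference quotients of [S],
    so they can be taken at [x] before integrating. *)
Lemma generator_sg_int t x z : 0 <= t -> sg_generator S x z -> sg_int t z = S t x - x.
Proof.
move=> t0 xz; have [J JE] := sg_int_bop t0.
apply: (@cvg_unique _ (@norm_hausdorff _ E) ((fun h => h^-1 *: (S h (sg_int t x) - sg_int t x)) @ 0^'+)).
  have lim : J (h^-1 *: (S h x - x)) @[h --> 0^'+] --> sg_int t z.
    by rewrite -JE; exact: bop_cvg.
  apply: cvg_trans lim; apply: near_eq_cvg; near=> h.
  have h0 : 0 <= h by apply: ltW; near: h; exact: nbhs_right_gt.
  by rewrite linearZ/= linearB/= !JE sg_int_commute.
exact: sg_int_generator.
Unshelve. all: by end_near. Qed.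

Lemma sg_generator_invariant t x z : 0 <= t ->
  sg_generator S x z -> sg_generator S (S t x) (S t z).
Proof.
move=> t0 xz; rewrite /sg_generator.
have lim : S t (h^-1 *: (S h x - x)) @[h --> 0^'+] --> S t z by exact: bop_cvg.
apply: cvg_trans lim; apply: near_eq_cvg; near=> h.
have h0 : 0 <= h by apply: ltW; near: h; exact: nbhs_right_gt.
by rewrite linearZ/= linearB/= sgC.
Unshelve. all: by end_near. Qed.

Local Notation Astar := (adjoint_graph (sg_generator S)).

(** The adjoint semigroup need not be strongly continuous; this identity is how the
    domain of the adjoint generator provides Lipschitz and weak*-differentiable
    orbits. *)
Lemma adjoint_int u v t x : Astar u v -> 0 <= t -> u (S t x) - u x = v (sg_int t x).
Proof.
by move=> uv t0; rewrite -linearB; apply: uv; exact: sg_int_generator.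
Qed.

Lemma adjoint_invariant u v t : Astar u v -> 0 <= t ->
  Astar (bop_adjoint (S t) u) (bop_adjoint (S t) v).
Proof.
move=> uv t0 x z xz; apply: uv.
exact: sg_generator_invariant.
Qed.

Lemma adjoint_derivative u v x : Astar u v ->
  h^-1 * (u (S h x) - u x) @[h --> 0^'+] --> (v x : R).
Proof.
move=> uv.
have lim : v (h^-1 *: sg_int h x) @[h --> 0^'+] --> v x by apply: bop_cvg; exact: sg_int_average.
apply: cvg_trans lim; apply: near_eq_cvg; near=> h.
have h0 : 0 <= h by apply: ltW; near: h; exact: nbhs_right_gt.
by rewrite linearZ/= (adjoint_int x uv h0).
Unshelve. all: by end_near. Qed.

Lemma adjoint_lipschitz u v t (M : R) :
  (forall s, 0 <= s <= t -> forall x, `|S s x| <= M * `|x|) -> 0 <= M -> 0 <= t ->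
  Astar u v -> `|bop_adjoint (S t) u - u| <= `|v| * (M * t).
Proof.
move=> SM M0 t0 uv; apply: bop_norm_le => [|x]; first by rewrite !mulr_ge0.
rewrite bopBE -[bop_adjoint _ _ _]/(u (S t x)) (adjoint_int x uv t0).
rewrite (le_trans (bop_norm _ _))// -mulrA ler_wpM2l//; exact: sg_int_norm.
Qed.

(** For every functional [y], the functional [y \o sg_int t] is in the domain of the
    adjoint generator, with image [y \o S t - y]. Hence [x] and [z] have the same
    [sg_int t], and the averages [t^-1 *: sg_int t] recover [x] and [z]. *)
Lemma adjoint_separates x z : (forall u v, Astar u v -> u x = u z) -> x = z.
Proof.
move=> xz.
have int_eq t : 0 <= t -> sg_int t x = sg_int t z.
  move=> t0; apply: dual_sep => y; have [J JE] := sg_int_bop t0; rewrite -!JE.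
  apply: (xz (bop_adjoint J y) (bop_adjoint (S t) y - y)) => a b ab.
  by rewrite bopBE -[LHS]/(y (J b)) JE (generator_sg_int t0 ab) linearB.
have lim : h^-1 *: sg_int h x @[h --> 0^'+] --> z.
  apply: cvg_trans (sg_int_average (x := z)); apply: near_eq_cvg; near=> h.
  have h0 : 0 <= h by apply: ltW; near: h; exact: nbhs_right_gt.
  by rewrite int_eq.
exact: (cvg_unique (@norm_hausdorff _ E) (sg_int_average (x := x)) lim).
Unshelve. all: by end_near. Qed.

End semigroup_theory.

(** * The covariance operator and its integrals along the semigroup *)

Section adjoints.
Context {R : realType} {E F : normedModType R}.

Lemma bop_adjointE (T : bop E F) (y : dual F) z : bop_adjoint T y z = y (T z).
Proof. by []. Qed.

Lemma bop_adjoint_linear (T : bop E F) a y z :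
  bop_adjoint T (a *: y + z) = a *: bop_adjoint T y + bop_adjoint T z.
Proof. exact: bop_ext. Qed.

Lemma bop_adjoint_norm (T : bop E F) (M : R) y : 0 <= M ->
  (forall z, `|T z| <= M * `|z|) -> `|bop_adjoint T y| <= M * `|y|.
Proof.
move=> M0 TM; apply: bop_norm_le => [|z]; first by rewrite mulr_ge0.
rewrite bop_adjointE (mulrC M) -mulrA (le_trans (bop_norm _ _))// ler_wpM2l//.
Qed.

End adjoints.

Section covariance.
Context {R : realType} {E H : completeNormedModType R}.
Variables (ip : {dot H for idfun}) (i : bop H E).
Hypothesis hip : forall h : H, ip h h = `|h| ^+ 2.
Local Notation adj := (riesz_adjoint ip i).
Local Notation Q := (covariance_op ip i).
Implicit Types x y : dual E.

Lemma riesz_adjointE x g : ip (adj x) g = x (i g).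
Proof.
have [h hx] := riesz_representation hip (bop_adjoint i x).
rewrite /riesz_adjoint; move: g.
by apply: (@xgetPex _ _ [set h | forall g, ip h g = x (i g)]); exists h.
Qed.

Lemma ip_ext (h h' : H) : (forall g, ip h g = ip h' g) -> h = h'.
Proof.
move=> hh'; apply/eqP; rewrite -subr_eq0 -normr_eq0 -sqrf_eq0 -hip ipBl.
by rewrite hh' subrr.
Qed.

Lemma covariance_dual x y : y (Q x) = ip (adj x) (adj y).
Proof. by rewrite /covariance_op -riesz_adjointE ipC. Qed.

Lemma covariance_symmetric : symmetric_op Q.
Proof. by move=> x y; rewrite !covariance_dual ipC. Qed.

Lemma covariance_positive : positive_op Q.
Proof. by move=> x; rewrite covariance_dual hip exprn_ge0. Qed.

Lemma covariance_linear : linear Q.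
Proof.
move=> a x y; rewrite /covariance_op -linearP; congr (i _).
by apply: ip_ext => g; rewrite ipDl ipZl !riesz_adjointE.
Qed.

Lemma riesz_adjoint_norm x : `|adj x| <= `|x| * `|i|.
Proof.
have [->|n0] := eqVneq (`|adj x|) 0; first by rewrite mulr_ge0.
have n0' : 0 < `|adj x| by rewrite lt_neqAle eq_sym n0/=.
rewrite -(ler_pM2r n0') -expr2 -hip riesz_adjointE -mulrA.
rewrite (le_trans (ler_norm _))// (le_trans (bop_norm _ _))// ler_wpM2l//.
exact: bop_norm.
Qed.

Lemma covariance_bounded x : `|Q x| <= `|i| ^+ 2 * `|x|.
Proof.
rewrite /covariance_op (le_trans (bop_norm _ _))// expr2 -mulrA ler_wpM2l// mulrC.
exact: riesz_adjoint_norm.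
Qed.

Variable S : R -> bop E E.
Hypothesis hS : C0_semigroup S.

(** The vectors [g s := i^* S^*(s) x] form a weakly continuous path in [H], so that
    each [g s] is in the closed span of the values of [g] at nonnegative rationals,
    and the Gram-Schmidt projections of [g s] converge to it. Composed with
    [S s \o i] they become continuous in [s], as their coefficients are
    [x (S s (i e))] for fixed vectors [e]. *)
Lemma covariance_path_approximable x :
  loc_approximable (fun s => S s (Q (bop_adjoint (S s) x))).
Proof.
move=> t t0; have [M M0 SM] := sg_bounded hS t.
(* An enumeration of the nonnegative rationals. *)
pose r k : R := `|ratr (odflt 0 (unpickle k))|.
pose g s : H := adj (bop_adjoint (S s) x).
pose q k : H := g (r k).
have gE s h : ip (g s) h = x (S s (i h)) by rewrite riesz_adjointE.
have gnorm s : 0 <= s <= t -> `|g s| <= M * `|x| * `|i|.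
  move=> st; rewrite (le_trans (riesz_adjoint_norm _))// ler_wpM2r//.
  by apply: bop_adjoint_norm => //; exact: SM.
apply: (@approximable_continuous_limit _ _ t (fun n s => S s (i (gs_proj ip q n (g s)))) _
    (M * (`|i| * (M * `|x| * `|i|)))) => //.
- elim=> [|n IH] s st.
    rewrite /= !linear0; apply: cvg_near_cst; apply: nearW => w.
    by rewrite /= !linear0.
  have cont z : S w z @[w --> within `[0, t] (nbhs s)] --> S s z.
    exact: (sg_continuous_on hS).
  have gsE w : S w (i (gs_proj ip q n.+1 (g w))) =
      S w (i (gs_proj ip q n (g w))) + x (S w (i (gs_vec ip q n))) *: S w (i (gs_vec ip q n)).
    rewrite gs_projS gE; move: (gs_vec ip q n) => e'.
    by rewrite linearD linearZ/= linearD linearZ.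
  rewrite gsE; under eq_fun do rewrite gsE.
  apply: cvgD; first exact: IH.
  by apply: cvgZ; [apply: bop_cvg|]; exact: cont.
- move=> n s st; rewrite (le_trans (SM s st _))// ler_wpM2l//.
  rewrite (le_trans (bop_norm _ _))// ler_wpM2l//.
  by rewrite (le_trans (gs_proj_norm hip _ _ _))// gnorm.
- move=> s /andP[s0 st].
  apply: bop_cvg; apply: bop_cvg; apply: gs_proj_cvg => // v qv.
  rewrite gE; apply/eqP; rewrite -normr_eq0; apply/negPn/negP => xs0.
  have s1 : 0 <= s <= s + 1 by rewrite s0 /= lerDl ler01.
  have e0 : 0 < `|x (S s (i v))| / 2 by rewrite divr_gt0// lt_neqAle eq_sym xs0/=.
  have : x (S w (i v)) @[w --> within `[0, s + 1] (nbhs s)] --> x (S s (i v)).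
    by apply: bop_cvg; exact: (sg_continuous_on hS s1).
  move=> /cvgrPdist_le/(_ _ e0); rewrite near_withinE => -[d /= d0 dx].
  have sd : s < s + Num.min d 1 by rewrite ltrDl lt_min d0/=.
  have [p] := rat_in_itvoo sd; rewrite in_itv/= => /andP[sp].
  rewrite -ltrBlDl lt_min => /andP[pd p1].
  have p0 : 0 <= ratr p :> R by rewrite (le_trans s0)// ltW.
  have := dx (ratr p); rewrite /= distrC gtr0_norm ?subr_gt0// in_itv/= p0/=.
  move=> /(_ pd); rewrite -lerBlDl (ltW p1) => /(_ isT).
  have := qv (pickle p); rewrite /q gE /r pickleK/= ger0_norm// => ->.
  rewrite subr0 ler_pdivlMr// mulr_natr mulr2n gerDl => h.
  by move: xs0; rewrite eq_le h normr_ge0.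
Qed.

End covariance.

Section covariance_integral.
Context {R : realType} {E : completeNormedModType R}.
Variable S : R -> bop E E.
Hypothesis hS : C0_semigroup S.
Variable Q : dual E -> E.
Hypotheses (lQ : linear Q) (symQ : symmetric_op Q) (posQ : positive_op Q).
Variable CQ : R.
Hypotheses (CQ0 : 0 <= CQ) (QC : forall x, `|Q x| <= CQ * `|x|).
Hypothesis aQ : forall x, loc_approximable (fun s => S s (Q (bop_adjoint (S s) x))).
Implicit Types (x y u v : dual E) (s t h : R).
Local Notation "S ^*( t )" := (bop_adjoint (S t)) (at level 2, format "S ^*( t )").

Definition qint t x : E := vint t (fun s => S s (Q (S^*(s) x))).

Lemma qint_dual t x y : 0 <= t ->
  y (qint t x) = \int[lebesgue_measure]_(s in `[0, t]) (S^*(s) y (Q (S^*(s) x)) : R).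
Proof. by move=> t0; rewrite /qint (vint_dual _ (aQ x) t0). Qed.

Lemma qint_symmetric t : 0 <= t -> symmetric_op (qint t).
Proof.
move=> t0 x y; rewrite !qint_dual//; apply: eq_Rintegral => s _.
exact: symQ.
Qed.

Lemma qint_positive t : 0 <= t -> positive_op (qint t).
Proof.
by move=> t0 x; rewrite qint_dual//; apply: Rintegral_ge0 => s _; exact: posQ.
Qed.

Lemma qint_linear t : 0 <= t -> linear (qint t).
Proof.
move=> t0 a x y; apply: vint_linear => // s _.
by rewrite bop_adjoint_linear lQ linearP.
Qed.

Lemma QB x y : Q (x - y) = Q x - Q y.
Proof. by rewrite addrC -scaleN1r lQ scaleN1r addrC. Qed.

Lemma qint_norm t (M : R) x : 0 <= t -> 0 <= M ->
  (forall s, 0 <= s <= t -> forall z, `|S s z| <= M * `|z|) ->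
  `|qint t x| <= M * (CQ * (M * `|x|)) * t.
Proof.
move=> t0 M0 SM; apply: vint_norm => // s st.
rewrite (le_trans (SM s st _))// ler_wpM2l// (le_trans (QC _))// ler_wpM2l//.
by apply: bop_adjoint_norm => //; exact: SM.
Qed.

Lemma adjointD s h x : 0 <= s -> 0 <= h -> S^*(s + h) x = S^*(s) (S^*(h) x).
Proof.
by move=> s0 h0; apply: bop_ext => z; rewrite !bop_adjointE sgD// sgC.
Qed.

Lemma adjoint0 x : S^*(0) x = x.
Proof. by apply: bop_ext => z; rewrite bop_adjointE sg0. Qed.

Lemma qint_cocycle t h x : 0 <= t -> 0 <= h ->
  qint (t + h) x = qint h x + S h (qint t (S^*(h) x)).
Proof.
move=> t0 h0.
pose g s := S h (S s (Q (S^*(s) (S^*(h) x)))).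
have ag : loc_approximable g.
  by move=> r r0; apply: simply_approximable_bop; exact: aQ.
rewrite -(vint_bop (aQ _) ag t0) => [|s _ //].
apply: vint_shift => // s /andP[s0 _].
by rewrite adjointD// (addrC s) sgD.
Qed.

Lemma qint_cocycle_dual t h x y : 0 <= t -> 0 <= h ->
  y (qint (t + h) x) = y (qint h x) + S^*(h) y (qint t (S^*(h) x)).
Proof. by move=> t0 h0; rewrite qint_cocycle// linearD. Qed.

Local Notation Astar := (adjoint_graph (sg_generator S)).

(** For [u] in the domain of the adjoint generator, [S^*(s) u] tends to [u] in norm
    as [s] tends to [0], so that the integrand is right-continuous at [0]; for a
    general functional it need not be. *)
Lemma qint_average u v : Astar u v -> h^-1 *: qint h u @[h --> 0^'+] --> Q u.
Proof.
move=> uv; have [M M0 SM] := sg_bounded hS 1.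
pose f s := S s (Q (S^*(s) u)).
have f0 : f 0 = Q u by rewrite /f adjoint0 sg0.
suff key : f s @[s --> 0^'+] --> f 0.
  by rewrite -f0; exact: (vint_average (f := f) (@aQ u) key).
rewrite f0; apply/cvgrPdist_le => e e0.
have e20 : 0 < e / 2 by rewrite divr_gt0.
have /cvgrPdist_le/(_ _ e20) cvg1 := sg_cvg0 hS (x := Q u).
pose K := M * (CQ * (`|v| * M)).
have K0 : 0 <= K by rewrite !mulr_ge0.
near=> s.
have s0 : 0 < s by near: s; exact: nbhs_right_gt.
have s1 : s <= 1 by near: s; exact: nbhs_right_le.
have sK : s <= e / 2 / (K + 1).
  by near: s; apply: nbhs_right_le; rewrite divr_gt0// ltr_wpDl.
have SMs r : 0 <= r <= s -> forall z, `|S r z| <= M * `|z|.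
  by move=> /andP[r0 rs]; apply: SM; rewrite r0 (le_trans rs).
have -> : Q u - f s = (Q u - S s (Q u)) - S s (Q (S^*(s) u - u)).
  by rewrite /f QB linearB/= opprB addrA subrK.
rewrite (le_trans (ler_normB _ _))// [e in leRHS]splitr; apply: lerD.
  by near: s; exact: cvg1.
have ss : 0 <= s <= 1 by rewrite s1 andbT ltW.
rewrite (le_trans (SM s ss _))//.
rewrite (@le_trans _ _ (K * s))//.
  rewrite /K -!mulrA ler_wpM2l// (le_trans (QC _))// ler_wpM2l//.
  by apply: (adjoint_lipschitz hS SMs M0 (ltW s0) uv).
rewrite (le_trans (ler_wpM2l K0 sK))// mulrCA; apply: ler_piMr; first exact: ltW.
by rewrite ler_pdivrMr ?ltr_wpDl// mul1r lerDl.
Unshelve. all: by end_near. Qed.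

End covariance_integral.

(** * Three forms of the Liapunov equation *)

(** For each [e > 0], the bound [`|F a - F 0| <= e * a] propagates from [0] to [t] by
    real induction. *)
Lemma right_derivative_zero (R : realType) (F : R -> R) (t C : R) : 0 <= t ->
  (forall a b, 0 <= a -> a <= b -> b <= t -> `|F b - F a| <= C * (b - a)) ->
  (forall s, 0 <= s < t -> h^-1 * (F (s + h) - F s) @[h --> 0^'+] --> 0) ->
  F t = F 0.
Proof.
move=> t0 lipF derF.
suff small e : 0 < e -> `|F t - F 0| <= e * t.
  apply/eqP; rewrite -subr_eq0 -normr_le0; apply/ler_addgt0Pr => e e0.
  rewrite add0r.
  have t10 : 0 < t + 1 by rewrite ltr_wpDl.
  rewrite (le_trans (small (e / (t + 1)) _)) ?divr_gt0//.
  by rewrite mulrAC ler_pdivrMr// ler_wpM2l ?lerDl// ltW.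
move=> e0; pose P a := `|F a - F 0| <= e * a.
apply: (@real_induction _ P) => //.
- by rewrite /P subrr normr0 mulr0.
- move=> a /andP[a0 at_] Pa.
  have /cvgrPdist_le/(_ e e0) : h^-1 * (F (a + h) - F a) @[h --> 0^'+] --> 0.
    by apply: derF; rewrite a0.
  move=> nearF; near (0 : R)^'+ => h.
  have h0 : 0 < h by near: h; exact: nbhs_right_gt.
  exists (a + h); split.
    rewrite ltrDl h0/= -lerBrDl; near: h; apply: nbhs_right_le.
    by rewrite subr_gt0.
  rewrite /P (le_trans (ler_distD (F a) _ _))// mulrDr [e * a + _]addrC lerD//.
  have : `|0 - h^-1 * (F (a + h) - F a)| <= e by near: h.
  by rewrite sub0r normrN normrM gtr0_norm ?invr_gt0// ler_pdivrMl// mulrC.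
- move=> c /andP[c0 ct] Pc; apply/ler_addgt0Pr => d d0.
  have C10 : 0 < `|C| + 1 by rewrite ltr_wpDl.
  have r0 : 0 < d / (`|C| + 1) by rewrite divr_gt0.
  have [a [a0 /andP[ca ac] Pa]] := Pc _ r0.
  rewrite (le_trans (ler_distD (F a) _ _))// addrC lerD//.
    by rewrite (le_trans Pa)// ler_wpM2l// ltW.
  rewrite (le_trans (lipF a c a0 (ltW ac) ct))//.
  have {}ca : c - a <= d / (`|C| + 1) by move: ca; lra.
  have ca0 : 0 <= c - a by rewrite subr_ge0 ltW.
  rewrite (@le_trans _ _ (`|C| * (c - a)))//; first by rewrite ler_wpM2r// ler_norm.
  rewrite (le_trans (ler_wpM2l _ ca))// mulrCA; apply: ler_piMr; first exact: ltW.
  by rewrite ler_pdivrMr// mul1r lerDl.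
Unshelve. all: by end_near. Qed.

Section liapunov.
Context {R : realType} {E : completeNormedModType R}.
Variable S : R -> bop E E.
Hypothesis hS : C0_semigroup S.
Variable Q : dual E -> E.
Hypotheses (lQ : linear Q) (symQ : symmetric_op Q).
Variable CQ : R.
Hypotheses (CQ0 : 0 <= CQ) (QC : forall x, `|Q x| <= CQ * `|x|).
Hypothesis aQ : forall x, loc_approximable (fun s => S s (Q (bop_adjoint (S s) x))).
Implicit Types (x y u v : dual E) (s t h : R).
Local Notation "S ^*( t )" := (bop_adjoint (S t)) (at level 2, format "S ^*( t )").
Local Notation Astar := (adjoint_graph (sg_generator S)).
Local Notation qint := (qint S Q).

Definition weak_liapunov (X : dual E -> E) := forall x x' u u',
  Astar x x' -> Astar u u' -> u' (X x) + u (X x') = - u (Q x).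

Definition integrated_liapunov (X : dual E -> E) := forall t x, 0 <= t ->
  X x = qint t x + S t (X (S^*(t) x)).

Lemma liapunov_weak X : liapunov_solution (sg_generator S) Q X -> weak_liapunov X.
Proof.
move=> [_ _ sol] x x' u u' xx' uu'; have [y Axy yE] := sol _ _ xx'.
by rewrite -(uu' _ _ Axy) -linearD yE linearN.
Qed.

Variable X : dual E -> E.
Hypotheses (lX : linear X) (symX : symmetric_op X).
Variable CX : R.
Hypotheses (CX0 : 0 <= CX) (XC : forall x, `|X x| <= CX * `|x|).

Lemma XB x y : X (x - y) = X x - X y.
Proof. by rewrite addrC -scaleN1r lX scaleN1r addrC. Qed.

(** The increment of [u (X x)] along the adjoint semigroup is the sum of two terms
    that are linear in one increment, whose quotients converge by weak*
    differentiability (using the symmetry of [X] for the second one), and of a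
    product of two increments, which is of order [h ^+ 2]. *)
Lemma form_derivative x x' u u' : Astar x x' -> Astar u u' ->
  h^-1 * (S^*(h) u (X (S^*(h) x)) - u (X x)) @[h --> 0^'+] --> (u' (X x) + u (X x') : R).
Proof.
move=> xx' uu'.
pose rest h : R := h^-1 * (S^*(h) u - u) (X (S^*(h) x - x)).
have rest0 : rest h @[h --> 0^'+] --> (0 : R).
  have [M M0 SM] := sg_bounded hS 1.
  pose K := `|u'| * M * (CX * (`|x'| * M)).
  have K0 : 0 <= K by rewrite !mulr_ge0.
  apply/cvgrPdist_le => e e0; near=> h.
  have h0 : 0 < h by near: h; exact: nbhs_right_gt.
  have h1 : h <= 1 by near: h; exact: nbhs_right_le.
  have hK : h <= e / (K + 1).
    by near: h; apply: nbhs_right_le; rewrite divr_gt0// ltr_wpDl.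
  have SMh r : 0 <= r <= h -> forall z, `|S r z| <= M * `|z|.
    by move=> /andP[r0 rh]; apply: SM; rewrite r0 (le_trans rh).
  have dx := adjoint_lipschitz hS SMh M0 (ltW h0) xx'.
  have du := adjoint_lipschitz hS SMh M0 (ltW h0) uu'.
  rewrite sub0r normrN /rest normrM gtr0_norm ?invr_gt0// ler_pdivrMl//.
  rewrite (@le_trans _ _ (K * h * h))//; last first.
    rewrite mulrC ler_pM2l// (le_trans (ler_wpM2l K0 hK))// mulrCA.
    apply: ler_piMr; first exact: ltW.
    by rewrite ler_pdivrMr ?ltr_wpDl// mul1r lerDl.
  rewrite (le_trans (bop_norm _ _))//.
  rewrite (@le_trans _ _ ((`|u'| * (M * h)) * (CX * (`|x'| * (M * h)))))//; last first.
    by rewrite /K le_eqVlt; apply/orP; left; apply/eqP; ring.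
  apply: ler_pM => //.
  by rewrite (le_trans (XC _))// ler_wpM2l.
have lim : h^-1 * (u (S h (X x)) - u (X x)) + h^-1 * (x (S h (X u)) - x (X u)) + rest h
    @[h --> 0^'+] --> (u' (X x) + u (X x') + 0 : R).
  apply: cvgD => //; apply: cvgD; first exact: adjoint_derivative.
  by rewrite -(symX u x'); exact: adjoint_derivative.
rewrite addr0 in lim; apply: cvg_trans lim; apply: near_eq_cvg; near=> h.
rewrite /rest -!mulrDr; congr (_ * _).
rewrite XB dualBE !dualB !bop_adjointE.
have -> : x (S h (X u)) = u (X (S^*(h) x)) by exact: (symX u (S^*(h) x)).
rewrite (symX u x); ring.
Unshelve. all: by end_near. Qed.

Lemma integrated_weak : integrated_liapunov X -> weak_liapunov X.
Proof.
move=> intX x x' u u' xx' uu'.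
have lim : - u (h^-1 *: qint h x) @[h --> 0^'+] --> (- u (Q x) : R).
  by apply: cvgN; apply: bop_cvg; exact: (qint_average hS lQ CQ0 QC aQ xx').
apply: (cvg_unique _ (form_derivative xx' uu')) => //.
apply: cvg_trans lim; apply: near_eq_cvg; near=> h.
have h0 : 0 <= h by apply: ltW; near: h; exact: nbhs_right_gt.
rewrite dualZ -mulrN; congr (_ * _).
by rewrite (intX h x h0) dualD bop_adjointE; ring.
Unshelve. all: by end_near. Qed.

Lemma weak_integrated : weak_liapunov X -> integrated_liapunov X.
Proof.
move=> weakX.
have main t x x' u u' : 0 <= t -> Astar x x' -> Astar u u' ->
    u (X x) = u (qint t x) + S^*(t) u (X (S^*(t) x)).
  move=> t0 xx' uu'.
  (* The pairing of [u] with the right-hand side of the integrated form: its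
     constancy in [s] is the claim. *)
  pose Phi s : R := S^*(s) u (X (S^*(s) x)) + u (qint s x).
  have Phi0 : Phi 0 = u (X x).
    by rewrite /Phi !(adjoint0 hS) /qint vint0// linear0 addr0.
  have PhiD s h : 0 <= s -> 0 <= h -> Phi (s + h) - Phi s =
    (S^*(h) (S^*(s) u) (X (S^*(h) (S^*(s) x))) - S^*(s) u (X (S^*(s) x))) +
    S^*(s) u (qint h (S^*(s) x)).
    move=> s0 h0; rewrite /Phi addrC (addrC s) (qint_cocycle_dual hS aQ)//.
    rewrite !(adjointD hS)//; ring.
  suff : Phi t = Phi 0 by rewrite Phi0 /Phi addrC => ->.
  have [M M0 SM] := sg_bounded hS t.
  have SM' s y : 0 <= s <= t -> `|S^*(s) y| <= M * `|y|.
    by move=> st; apply: bop_adjoint_norm => //; exact: SM.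
  pose K y : R := M * `|y| * M.
  have lip y y' a b : Astar y y' -> 0 <= a -> a <= b -> b <= t ->
      `|S^*(b) y - S^*(a) y| <= K y' * (b - a).
    move=> yy' a0 ab bt; have ba0 : 0 <= b - a by rewrite subr_ge0.
    have SMba r : 0 <= r <= b - a -> forall z, `|S r z| <= M * `|z|.
      move=> /andP[r0 rba]; apply: SM; rewrite r0 (le_trans rba)//.
      by rewrite (le_trans _ bt)// gerBl.
    have := adjoint_lipschitz hS SMba M0 ba0 (adjoint_invariant hS yy' a0).
    rewrite -(adjointD hS)// subrK => /le_trans; apply.
    rewrite /K -mulrA ler_wpM2r ?mulr_ge0// SM'// a0 (le_trans ab)//.
  apply: (@right_derivative_zero _ Phi t (K u' * (CX * (M * `|x|)) +
     M * `|u| * (CX * K x') + M * `|u| * (M * (CQ * (M * (M * `|x|)))))) => //.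
    move=> a b a0 ab bt; have ba0 : 0 <= b - a by rewrite subr_ge0.
    have at_ : 0 <= a <= t by rewrite a0 (le_trans ab).
    have bt_ : 0 <= b <= t by rewrite bt (le_trans a0).
    have -> : Phi b - Phi a = (S^*(b) u - S^*(a) u) (X (S^*(b) x)) +
        S^*(a) u (X (S^*(b) x - S^*(a) x)) + S^*(a) u (qint (b - a) (S^*(a) x)).
      have := PhiD a (b - a) a0 ba0; rewrite -!(adjointD hS)// (addrC a) subrK => ->.
      by rewrite XB dualBE dualB; ring.
    rewrite (le_trans (ler_normD _ _))// mulrDl lerD//.
      rewrite (le_trans (ler_normD _ _))// mulrDl lerD//.
        rewrite (le_trans (bop_norm _ _))// mulrAC ler_pM//; first exact: lip uu' _ _ _.
        by rewrite (le_trans (XC _))// ler_wpM2l// SM'.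
      rewrite (le_trans (bop_norm _ _))// -mulrA ler_pM//; first exact: SM'.
      rewrite (le_trans (XC _))// -mulrA ler_wpM2l//; exact: lip xx' _ _ _.
    rewrite (le_trans (bop_norm _ _))// -mulrA ler_pM//; first exact: SM'.
    have SMba r : 0 <= r <= b - a -> forall z, `|S r z| <= M * `|z|.
      move=> /andP[r0 rba]; apply: SM; rewrite r0 (le_trans rba)//.
      by rewrite (le_trans _ bt)// gerBl.
    rewrite (le_trans (qint_norm CQ0 QC aQ (S^*(a) x) ba0 M0 SMba))//.
    by rewrite ler_wpM2r// ler_wpM2l// ler_wpM2l// ler_wpM2l// SM'.
  move=> s /andP[s0 st].
  have xs := adjoint_invariant hS xx' s0; have us := adjoint_invariant hS uu' s0.
  have lim : h^-1 * (S^*(h) (S^*(s) u) (X (S^*(h) (S^*(s) x))) - S^*(s) u (X (S^*(s) x)))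
     + S^*(s) u (h^-1 *: qint h (S^*(s) x)) @[h --> 0^'+] --> (0 : R).
    rewrite -[X in _ --> X](subrr (- S^*(s) u (Q (S^*(s) x)))) opprK.
    apply: cvgD; first by rewrite -(weakX _ _ _ _ xs us); exact: form_derivative.
    by apply: bop_cvg; exact: (qint_average hS lQ CQ0 QC aQ xs).
  apply: cvg_trans lim; apply: near_eq_cvg; near=> h.
  have h0 : 0 <= h by apply: ltW; near: h; exact: nbhs_right_gt.
  by rewrite dualZ PhiD// -mulrDr.
(* Symmetry lets [D(A^* )] act on either argument: separation first frees [u],
   then [x]. *)
have onD t x x' : 0 <= t -> Astar x x' -> X x = qint t x + S t (X (S^*(t) x)).
  move=> t0 xx'; apply: (adjoint_separates hS) => u u' uu'.
  by rewrite (main t x x' u u')// linearD.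
move=> t x t0; apply: (adjoint_separates hS) => u u' uu'.
rewrite symX (onD t u u')// !linearD/=; congr (_ + _).
  by rewrite (qint_symmetric symQ aQ).
by rewrite -[LHS]/(S^*(t) x (X (S^*(t) u))) symX.
Unshelve. all: by end_near. Qed.

Lemma weak_generator x x' : weak_liapunov X -> Astar x x' ->
  sg_generator S (X x) (- Q x - X x').
Proof.
move=> weakX xx'; set w := - Q x - X x'.
have intE t : 0 <= t -> S t (X x) - X x = sg_int S t w.
  move=> t0; apply: (adjoint_separates hS) => u u' uu'.
  rewrite linearB/= (adjoint_int hS (X x) uu' t0) /sg_int.
  rewrite (vint_dual u' (sg_approximable hS (X x)) t0).
  rewrite (vint_dual u (sg_approximable hS w) t0).
  apply: eq_Rintegral => s; rewrite inE/= in_itv/= => /andP[s0 _].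
  have := weakX _ _ _ _ xx' (adjoint_invariant hS uu' s0).
  rewrite !bop_adjointE /w !linearB/= !linearN/= => /(canRL (addrK _)) ->.
  by rewrite addrC.
rewrite /sg_generator.
apply: cvg_trans (sg_int_average hS (x := w)); apply: near_eq_cvg; near=> h.
have h0 : 0 <= h by apply: ltW; near: h; exact: nbhs_right_gt.
by rewrite intE.
Unshelve. all: by end_near. Qed.

Lemma weak_solution : weak_liapunov X -> liapunov_solution (sg_generator S) Q X.
Proof.
move=> weakX; split=> //; first exact: linear_bounded_cont XC.
move=> x x' xx'; exists (- Q x - X x'); first exact: weak_generator.
by rewrite subrK.
Qed.

End liapunov.

(** * Monotone convergence of the covariance integrals *)

Section monotone_limits.
Context {R : realType} {E : completeNormedModType R}.
Variable S : R -> bop E E.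
Hypothesis hS : C0_semigroup S.
Variable Q : dual E -> E.
Hypotheses (lQ : linear Q) (symQ : symmetric_op Q) (posQ : positive_op Q).
Hypothesis aQ : forall x, loc_approximable (fun s => S s (Q (bop_adjoint (S s) x))).
Implicit Types (x y u v : dual E) (s t h : R).
Local Notation "S ^*( t )" := (bop_adjoint (S t)) (at level 2, format "S ^*( t )").
Local Notation qint := (qint S Q).

(** Expand [0 <= (t *: x + y) (X (t *: x + y))]. *)
Lemma positive_cauchy_schwarz (X : dual E -> E) x y :
  linear X -> symmetric_op X -> positive_op X ->
  (y (X x) : R) ^+ 2 <= (y (X y) : R) * x (X x).
Proof.
move=> lX sX pX; apply: discriminant_le => [|t]; first exact: pX.
suff -> : (y (X y) : R) + 2 * y (X x) * t + x (X x) * t ^+ 2 =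
  (t *: x + y) (X (t *: x + y)) by exact: pX.
by rewrite lX dualDE dualZE !dualD !dualZ (sX y x); ring.
Qed.

Lemma qint_mono t h x : 0 <= t -> 0 <= h -> x (qint t x) <= x (qint (h + t) x) :> R.
Proof.
move=> t0 h0; rewrite (qint_cocycle_dual hS aQ)// lerDl.
exact: (qint_positive posQ aQ).
Qed.

Lemma integrated_qint_le (X : dual E -> E) t x : positive_op X ->
  integrated_liapunov S Q X -> 0 <= t -> x (qint t x) <= x (X x) :> R.
Proof.
move=> pX intX t0; rewrite (intX t x t0) dualD lerDl.
exact: (pX (S^*(t) x)).
Qed.

(** The increments [D := qint t - qint s] are positive and symmetric, and below [X].
    For [y] in the unit ball, Cauchy-Schwarz gives
    [(y (D x)) ^+ 2 <= y (D y) * x (D x) <= C * x (D x)], and [x (D x)] is an increment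
    of the bounded nondecreasing function [t |-> x (qint t x)]. *)
Lemma integrated_qint_cvg (X : dual E -> E) (C : R) x : positive_op X ->
  0 <= C -> (forall y, `|X y| <= C * `|y|) ->
  integrated_liapunov S Q X -> cvg (qint t x @[t --> +oo]).
Proof.
move=> pX C0 XC intX.
pose b t : R := x (qint t x).
have b_le t : 0 <= t -> b t <= x (X x) by move=> t0; exact: integrated_qint_le.
have b_mono s t : 0 <= s -> s <= t -> b s <= b t.
  by move=> s0 st; rewrite -[t](subrK s); apply: qint_mono; rewrite // subr_ge0.
have dist s t : 0 <= s -> s <= t -> `|qint t x - qint s x| ^+ 2 <= C * (b t - b s).
  move=> s0 st; have ts0 : 0 <= t - s by rewrite subr_ge0.
  have t0 : 0 <= t by rewrite (le_trans s0).
  have incr y z : y (qint t z) - y (qint s z) = S^*(s) y (qint (t - s) (S^*(s) z)) :> R.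
    by rewrite -{1}[t](subrK s) (qint_cocycle_dual hS aQ z y ts0 s0) addrC addKr.
  have [y [yu <-]] := norming_functional (qint t x - qint s x).
  have y1 : `|y| <= 1 by apply: bop_norm_le => // z; rewrite mul1r.
  rewrite dualB incr.
  apply: (le_trans (positive_cauchy_schwarz (S^*(s) x) (S^*(s) y)
    (qint_linear lQ aQ ts0) (qint_symmetric symQ aQ ts0) (qint_positive posQ aQ ts0))).
  rewrite -!incr; apply: ler_pM.
  - by rewrite incr; exact: (qint_positive posQ aQ).
  - by rewrite incr; exact: (qint_positive posQ aQ).
  - rewrite (@le_trans _ _ (y (qint t y)))//.
      by rewrite gerBl; exact: (qint_positive posQ aQ).
    rewrite (le_trans (integrated_qint_le y pX intX t0))//.
    rewrite (le_trans (ler_norm _))// (le_trans (yu _))// (le_trans (XC _))//.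
    by rewrite ler_piMr.
  - exact: lexx.
pose B := [set b t | t in [set t | 0 <= t]].
have supB : has_sup B.
  split; first by exists (b 0), 0 => /=.
  by exists (x (X x)) => _ [t /= t0 <-]; exact: b_le.
apply: cauchy_cvg_dist => e e0.
(* [C + 1] rather than [C], which may vanish. *)
have d0 : 0 < e ^+ 2 / (C + 1) by rewrite divr_gt0// ?exprn_gt0// ltr_wpDl.
have [_ [r /= r0 <-] rB] := sup_adherent d0 supB.
exists [set t | r <= t]; split; first by apply: nbhs_pinfty_ge; exact: num_real.
move=> s t; wlog st : s t / s <= t.
  move=> wl rs rt; have [st|/ltW ts] := leP s t; first exact: wl.
  by rewrite distrC; exact: wl.
move=> /= rs rt; rewrite distrC -(@ler_pXn2r _ 2)// ?nnegrE ?(ltW e0)//.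
rewrite (le_trans (dist _ _ (le_trans r0 rs) st))//.
have bsup : b t <= sup B.
  by apply: ub_le_sup; [exact: supB.2|exists t => //=; exact: le_trans rt].
have bs := b_mono _ _ r0 rs.
have db : b t - b s <= e ^+ 2 / (C + 1) by lra.
rewrite (le_trans (ler_wpM2l C0 db))// mulrCA; apply: ler_piMr.
  by rewrite exprn_ge0// ltW.
by rewrite ler_pdivrMr ?ltr_wpDl// mul1r lerDl.
Qed.

Variable X : dual E -> E.
Hypothesis XlimP : forall x y, y (qint t x) @[t --> +oo] --> (y (X x) : R).

Lemma near_pinfty_ge0 : \forall t \near +oo, 0 <= t :> R.
Proof. by apply: nbhs_pinfty_ge; exact: num_real. Qed.

Lemma limit_symmetric : symmetric_op X.
Proof.
move=> x y; apply: (cvg_unique (@Rhausdorff R) (@XlimP x y)).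
apply: cvg_trans (XlimP (x := y) (y := x)); apply: near_eq_cvg.
apply: filterS near_pinfty_ge0 => t t0.
exact: (qint_symmetric symQ aQ t0).
Qed.

Lemma limit_positive : positive_op X.
Proof.
move=> x; apply: (cvgr_to_ge (XlimP (x := x) (y := x))).
by apply: filterS near_pinfty_ge0 => t t0; exact: (qint_positive posQ aQ).
Qed.

Lemma limit_linear : linear X.
Proof.
move=> a x z; apply: dual_sep => y.
have lim : a * y (qint t x) + y (qint t z) @[t --> +oo] --> (a * y (X x) + y (X z) : R).
  by apply: cvgD; [apply: cvgMl_tmp|]; exact: XlimP.
rewrite dualD dualZ; apply: (cvg_unique _ (XlimP (x := a *: x + z) (y := y))) => //.
apply: cvg_trans lim; apply: near_eq_cvg.
apply: filterS near_pinfty_ge0 => t t0.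
by rewrite (qint_linear lQ aQ t0) dualD dualZ.
Qed.

(** Let [t] tend to infinity in [qint_cocycle] with [h] fixed. *)
Lemma limit_integrated : integrated_liapunov S Q X.
Proof.
move=> h x h0; apply: dual_sep => y.
have lim1 : y (qint (t + h) x) @[t --> +oo] --> (y (X x) : R).
  by rewrite (cvg_shiftr h (fun t => y (qint t x) : R)); exact: XlimP.
apply: (cvg_unique _ lim1) => //.
have lim2 : y (qint h x) + S^*(h) y (qint t (S^*(h) x)) @[t --> +oo] -->
    (y (qint h x) + S^*(h) y (X (S^*(h) x)) : R).
  by apply: cvgD; [exact: cvg_cst|exact: XlimP].
rewrite dualD; apply: cvg_trans lim2; apply: near_eq_cvg.
apply: filterS near_pinfty_ge0 => t t0.
by rewrite (qint_cocycle_dual hS aQ).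
Qed.

End monotone_limits.

Lemma Qt_qint (R : realType) (E : completeNormedModType R) (S : R -> bop E E) Q t x :
  Qt S Q t x = qint S Q t x.
Proof. by rewrite /qint vint.unlock. Qed.

Unset Implicit Arguments.
Set Strict Implicit.

Theorem theorem4p4 (R : realType) (E H : completeNormedModType R)
    (S : R -> bop E E) (ip : {dot H for idfun}) (i : bop H E)
    (hS : C0_semigroup S)
    (hip : forall h : H, ip h h = `|h| ^+ 2)
    (hi : injective i) :
  let A := sg_generator S in
  let Q := covariance_op ip i in
  let weak_limits_exist := forall xs : dual E,
    exists l : E, weakly_cvg +oo (fun t => Qt S Q t xs) l in
  ((exists X : dual E -> E, positive_symmetric_solution A Q X) <->
    weak_limits_exist) /\
  (weak_limits_exist ->
    positive_symmetric_solution A Q (Qinfty S Q) /\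
    forall X : dual E -> E, positive_symmetric_solution A Q X ->
      forall xs : dual E, xs (Qinfty S Q xs) <= xs (X xs)).
Proof.
move=> A Q weak_limits_exist.
have lQ : linear Q by exact: covariance_linear.
have symQ : symmetric_op Q by exact: covariance_symmetric.
have posQ : positive_op Q by exact: covariance_positive.
have QC : forall x, `|Q x| <= `|i| ^+ 2 * `|x| by exact: covariance_bounded.
have CQ0 : 0 <= `|i| ^+ 2 by exact: exprn_ge0.
have aQ : forall x, loc_approximable (fun s => S s (Q (bop_adjoint (S s) x))).
  by move=> x; exact: covariance_path_approximable.
have sol_integrated X : positive_symmetric_solution A Q X -> integrated_liapunov S Q X.
  move=> [solX posX symX]; have [lX cX _] := solX.
  have [C C0 XC] := linear_cont_bounded lX cX.
  exact: (weak_integrated hS lQ symQ CQ0 QC aQ lX symX C0 XC (liapunov_weak solX)).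
have limP : weak_limits_exist -> forall x y : dual E,
    y (qint S Q t x) @[t --> +oo] --> (y (Qinfty S Q x) : R).
  move=> wl x y.
  have : weakly_cvg +oo (fun t => Qt S Q t x) (Qinfty S Q x).
    have [l xl] := wl x.
    by apply: (@xgetPex _ 0 [set l | weakly_cvg +oo (fun t => Qt S Q t x) l]); exists l.
  by move=> /(_ y); under eq_fun do rewrite Qt_qint.
have Qinfty_sol : weak_limits_exist -> positive_symmetric_solution A Q (Qinfty S Q).
  move=> wl; have QlimP := limP wl.
  have lX := limit_linear lQ aQ QlimP.
  have symX := limit_symmetric symQ aQ QlimP.
  have posX := limit_positive posQ aQ QlimP.
  have intX := limit_integrated hS aQ QlimP.
  have [C C0 XC] := symmetric_linear_bounded lX symX.
  split => //; apply: (weak_solution hS lX XC).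
  exact: (integrated_weak hS lQ CQ0 QC aQ lX symX C0 XC intX).
split; first split.
- move=> [X solX] xs; have intX := sol_integrated _ solX.
  have [[lX cX _] posX symX] := solX.
  have [C C0 XC] := linear_cont_bounded lX cX.
  have /cvg_ex[l xl] := integrated_qint_cvg hS lQ symQ posQ aQ (x := xs) posX C0 XC intX.
  exists l => y; under eq_fun do rewrite Qt_qint.
  exact: bop_cvg.
- by move=> wl; exists (Qinfty S Q); exact: Qinfty_sol.
- move=> wl; split; first exact: Qinfty_sol.
  move=> X solX xs; have intX := sol_integrated _ solX.
  have [_ posX _] := solX.
  apply: (cvgr_to_le (limP wl xs xs)).
  apply: filterS (@near_pinfty_ge0 R) => t t0.
  exact: integrated_qint_le.
Qed.
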